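(* Consider $N$ mobile robots $i\in\{1,\dots,N\}$ with headings $\theta_i(t)\in\mathbb{S}^1=[0,2\pi)$, communicating over a (strongly) connected topology and running the rate-constrained pulse-coupled heading control described in the context with the phase response function $F(\phi)=\alpha Q(\phi)$, where $\alpha\in(0,1]$ and $$Q(\phi)=\begin{cases}-\phi & 0\le \phi\le \pi,\\ 2\pi-\phi & \pi<\phi<2\pi,\end{cases}$$ together with a refractory period $D\in[0,2\pi)$. Suppose the initial headings lie in a containing arc of length less than some $\bar\Lambda\in(0,\pi]$, and that $D\le 2\pi-\bar\Lambda$. Then the headings of all robots synchronize, i.e. the length $\Lambda$ of the containing arc of the headings converges to $0$, while the heading rate constraint $|\dot\theta_i|\le\omega_{\max}$ is satisfied at all times.
   Context: Rate-constrained pulse-coupled heading control: each robot $i$ has a heading $\theta_i\in[0,2\pi)$ and an auxiliary phase variable $\phi_i\in[0,2\pi)$ with $\phi_i(0)=\theta_i(0)$. Fix a fundamental frequency $\omega_0>0$ and a maximum rotation rate $\omega_{\max}>0$. The phase evolves as $\dot\phi_i=\omega_i$, where normally $\omega_i=\omega_0$. When $\phi_i$ reaches $2\pi$, robot $i$ fires a pulse, received instantly by all its neighbors, and $\phi_i$ is reset to $0$. When robot $i$ receives a pulse (and, if a refractory period $D$ is used, its phase is not in $[0,D)$; pulses received while $\phi_i\in[0,D)$ are ignored), it computes the desired adjustment $\psi_i=F(\phi_i)$ from its current phase, sets $\omega_i=\omega_0+\omega_{\max}$ if $\psi_i>0$ or $\omega_i=\omega_0-\omega_{\max}$ if $\psi_i<0$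 (and $\omega_i=\omega_0$ if $\psi_i=0$), keeps this rate for duration $\tau_i=|\psi_i|/\omega_{\max}$, and then returns to $\omega_i=\omega_0$; if a new pulse is received before $\tau_i$ has elapsed, the adjustment is recomputed from the current phase, replacing the old one. The heading is driven by $\dot\theta_i=\dot\phi_i-\omega_0$, so $|\dot\theta_i|\le\omega_{\max}$ and $\theta_i=(\phi_i-\omega_0 t)\bmod 2\pi$. An arc is a connected subset of the circle $[0,2\pi)$; the containing arc of a set of points on the circle is the smallest arc containing them all. If the values are sorted $x_1\le\dots\le x_N$ and $v_{i,i+1}=x_{i+1}-x_i$ for $i<N$, $v_{N,1}=2\pi-(x_N-x_1)$, its length is $\Lambda=2\pi-\max_i v_{i,i+1}$. *)

(* Defs.v *)
From Stdlib Require Import Reals Lra List Relations.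
Import ListNotations.
Open Scope R_scope.

(** [x mod 2π], a representative in [0, 2π) (Int_part is the floor). *)
Definition mod2pi (x : R) : R := x - 2 * PI * IZR (Int_part (x / (2 * PI))).

Fixpoint rinsert (x : R) (l : list R) : list R :=
  match l with
  | [] => [x]
  | y :: l' => if Rle_dec x y then x :: y :: l' else y :: rinsert x l'
  end.

Definition rsort (l : list R) : list R := fold_right rinsert [] l.

Fixpoint diffs (l : list R) : list R :=
  match l with
  | x :: ((y :: _) as t) => (y - x) :: diffs t
  | _ => []
  end.

Definition gaps (s : list R) : list R :=
  diffs s ++ [2 * PI - (last s 0 - hd 0 s)].

(** Λ = 2π - max_i v_{i,i+1}, for the values x (assumed in [0,2π)) *)
Definition arc_length (x : list R) : R :=
  2 * PI - fold_right Rmax 0 (gaps (rsort x)).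

Definition Q (phi : R) : R :=
  if Rle_dec phi PI then - phi else 2 * PI - phi.

(** Rate applied at time [t] by a robot that computed the adjustment [psi]
    at time [s] (kept for duration |psi|/omega_max, i.e. on [s, s+tau)). *)
Definition rate_after (w0 wmax psi s t : R) : R :=
  if Rlt_dec 0 psi then
    (if Rlt_dec t (s + psi / wmax) then w0 + wmax else w0)
  else if Rlt_dec psi 0 then
    (if Rlt_dec t (s + (- psi) / wmax) then w0 - wmax else w0)
  else w0.

(** * Executions of the pulse-coupled system

   [Phi i] is the unwrapped (lifted) phase of robot i: the actual phase is
   [phi_i(t) = mod2pi (Phi i t)], which is reset to 0 each time it reaches 2π.
   [om i] is the phase rate ω_i. *)

Definition phase (Phi : nat -> R -> R) (i : nat) (t : R) : R := mod2pi (Phi i t).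

Definition heading (w0 : R) (Phi : nat -> R -> R) (i : nat) (t : R) : R :=
  mod2pi (Phi i t - w0 * t).

(** robot i fires at time t: its phase reaches 2π (from below) at t. *)
Definition fires (Phi : nat -> R -> R) (i : nat) (t : R) : Prop :=
  0 < t /\ exists k : Z, Phi i t = 2 * PI * IZR k /\
     exists eps, 0 < eps /\ forall u, t - eps < u < t -> Phi i u < 2 * PI * IZR k.

Definition receives (N : nat) (adj : nat -> nat -> Prop) (D : R)
    (Phi : nat -> R -> R) (i : nat) (s : R) : Prop :=
  (exists j, (j < N)%nat /\ adj j i /\ fires Phi j s) /\
  ~ (0 <= phase Phi i s < D).

(** [adj j i] : i is a neighbour of j (i receives j's pulses).
    Strong connectivity of the directed graph on {0,..,N-1}. *)
Definition edge_in (N : nat) (adj : nat -> nat -> Prop) (a b : nat) : Prop :=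
  (a < N)%nat /\ (b < N)%nat /\ adj a b.

Definition strongly_connected (N : nat) (adj : nat -> nat -> Prop) : Prop :=
  forall i j, (i < N)%nat -> (j < N)%nat ->
    clos_refl_trans nat (edge_in N adj) i j.

Definition is_execution (N : nat) (adj : nat -> nat -> Prop)
    (w0 wmax alpha D : R) (theta0 : nat -> R)
    (Phi om : nat -> R -> R) : Prop :=
  forall i, (i < N)%nat ->
    Phi i 0 = theta0 i /\
    (forall t, 0 <= t -> forall eps, 0 < eps -> exists delta, 0 < delta /\
        forall u, 0 <= u -> Rabs (u - t) < delta -> Rabs (Phi i u - Phi i t) < eps) /\
    (forall t, 0 <= t -> forall eps, 0 < eps -> exists delta, 0 < delta /\
        forall h, 0 < h < delta ->
          Rabs ((Phi i (t + h) - Phi i t) / h - om i t) < eps) /\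
    (forall t, 0 <= t ->
       ((forall s, 0 <= s <= t -> ~ receives N adj D Phi i s) /\ om i t = w0)
       \/
       (exists s, 0 <= s <= t /\ receives N adj D Phi i s /\
          (forall u, s < u <= t -> ~ receives N adj D Phi i u) /\
          om i t = rate_after w0 wmax (alpha * Q (phase Phi i s)) s t)).

Definition headings_at (N : nat) (w0 : R) (Phi : nat -> R -> R) (t : R) : list R :=
  map (fun i => heading w0 Phi i t) (seq 0 N).

(* Main.v *)
(** Lift the headings to the line so that they start in an interval of length less than π.
    When robot j fires, every receiver i turns towards the point x_i + α (x_j - x_i), so the
    interval spanned by all headings and all targets never grows; let [A, B] be its limit and
    suppose A < B. A pulse is fired when a robot meets a level that sweeps downwards through the
    interval once per revolution, higher robots first. During a sweep a robot that has not yet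
    been met can only be pulled up, and never ignores a pulse because D <= 2π - Λbar. Some robot
    is at least a fixed distance above A when the sweep begins; its pulse, sent before the robots
    near A are met, lifts each of its neighbours by a fixed fraction of that distance, and by
    strong connectivity every robot is met at a level A + δ with δ > 0 independent of the sweep.
    All later targets then lie above A + δ, and after finitely many sweeps the stale targets have
    been reached as well, so the whole interval lies above A + δ, contradicting the choice of A. *)

Require Import Defs.
From Stdlib Require Import Reals List Relations Lra Lia ZArith Classical ClassicalEpsilon Sorted.
Import ListNotations.
Open Scope R_scope.

(** * Functions with a right derivative *)

(** Induction along the half-line: the supremum of the initial segments on which [P] holds belongs
    to them by the second premise and is not maximal by the third. It replaces an enumeration of
    pulses, which would first require an ordering of the event times. *)
Lemma real_induction (P : R -> Prop) (a : R) :
  P a ->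
  (forall t, a < t -> (forall u, a <= u < t -> P u) -> P t) ->
  (forall t, a <= t -> P t -> exists eta, 0 < eta /\ forall u, t < u < t + eta -> P u) ->
  forall t, a <= t -> P t.
Proof.
  intros Pa Hleft Hright t1 Ht1.
  apply NNPP; intros HnP.
  set (E := fun u => a <= u /\ forall v, a <= v <= u -> P v).
  destruct (completeness E) as [m [Hub Hlub]].
  - exists t1. intros u [Hu HP]. apply Rnot_lt_le. intros Hlt. apply HnP, HP. lra.
  - exists a. split; [lra|]. intros v Hv. replace v with a by lra. exact Pa.
  - assert (Ham : a <= m).
    { apply Hub. split; [lra|]. intros v Hv. replace v with a by lra. exact Pa. }
    assert (Hbelow : forall v, a <= v < m -> P v).
    { intros v Hv. apply NNPP; intros Hn.
      assert (m <= v); [|lra].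
      apply Hlub. intros u [Hu HP]. apply Rnot_lt_le. intros Hlt. apply Hn, HP. lra. }
    assert (HPm : P m).
    { destruct (Rle_lt_or_eq_dec a m Ham) as [Hlt|<-]; auto. }
    destruct (Hright m Ham HPm) as [eta [Heta HP]].
    assert (m + eta / 2 <= m); [|lra].
    apply Hub. split; [lra|]. intros v Hv.
    destruct (Rtotal_order v m) as [Hlt|[->|Hgt]]; auto.
    + apply Hbelow; lra.
    + apply HP; lra.
Qed.

(** This predicate and the next repeat the continuity and rate clauses of [is_execution]. Only right
    derivatives are available, since the rate jumps when a pulse arrives. *)
Definition continuous_nonneg (f : R -> R) : Prop :=
  forall t, 0 <= t -> forall eps, 0 < eps -> exists delta, 0 < delta /\
    forall u, 0 <= u -> Rabs (u - t) < delta -> Rabs (f u - f t) < eps.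

Definition right_derivative (f g : R -> R) : Prop :=
  forall t, 0 <= t -> forall eps, 0 < eps -> exists delta, 0 < delta /\
    forall h, 0 < h < delta -> Rabs ((f (t + h) - f t) / h - g t) < eps.

Lemma continuous_nonneg_opp (f : R -> R) :
  continuous_nonneg f -> continuous_nonneg (fun t => - f t).
Proof.
  intros Hf t Ht eps Heps. destruct (Hf t Ht eps Heps) as [d [Hd H]].
  exists d; split; auto. intros u Hu Hut.
  replace (- f u - - f t) with (- (f u - f t)) by ring.
  rewrite Rabs_Ropp; auto.
Qed.

Lemma right_derivative_opp (f g : R -> R) :
  right_derivative f g -> right_derivative (fun t => - f t) (fun t => - g t).
Proof.
  intros Hf t Ht eps Heps. destruct (Hf t Ht eps Heps) as [d [Hd H]].
  exists d; split; auto. intros h Hh.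
  replace ((- f (t + h) - - f t) / h - - g t) with (- ((f (t + h) - f t) / h - g t))
    by (field; lra).
  rewrite Rabs_Ropp; auto.
Qed.

Lemma continuous_nonneg_lt (f : R -> R) (t c : R) :
  continuous_nonneg f -> 0 <= t -> f t < c ->
  exists eta, 0 < eta /\ forall u, 0 <= u -> Rabs (u - t) < eta -> f u < c.
Proof.
  intros Hf Ht Hc. destruct (Hf t Ht (c - f t)) as [d [Hd H]]; [lra|].
  exists d; split; auto. intros u Hu Hut.
  specialize (H u Hu Hut). apply Rabs_def2 in H. lra.
Qed.

Lemma left_limit_le (f : R -> R) (a t c : R) :
  continuous_nonneg f -> 0 <= a < t -> (forall u, a <= u < t -> f u <= c) -> f t <= c.
Proof.
  intros Hf Hat Hu. apply Rnot_lt_le. intros Hlt.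
  destruct (Hf t ltac:(lra) (f t - c)) as [d [Hd H]]; [lra|].
  set (u := Rmax a (t - d / 2)).
  assert (Hul : a <= u /\ t - d / 2 <= u /\ u < t)
    by (unfold u, Rmax; destruct Rle_dec; lra).
  specialize (Hu u ltac:(lra)).
  specialize (H u ltac:(lra) ltac:(apply Rabs_def1; lra)).
  apply Rabs_def2 in H. lra.
Qed.

Lemma first_hit (f : R -> R) (a b c : R) :
  continuous_nonneg f -> 0 <= a -> a <= b -> f a < c -> c <= f b ->
  exists s, a < s <= b /\ f s = c /\ forall u, a <= u < s -> f u < c.
Proof.
  intros Hf Ha Hab Hfa Hfb. apply NNPP; intros Hn.
  assert (H : forall t, a <= t -> t <= b -> f t < c).
  { apply (real_induction (fun t => t <= b -> f t < c)); auto.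
    - intros t Hat Hu Htb.
      assert (Hle : f t <= c).
      { apply (left_limit_le f a); auto. intros u Hau.
        apply Rlt_le, Hu; lra. }
      destruct (Rle_lt_or_eq_dec _ _ Hle) as [?|He]; auto.
      exfalso; apply Hn. exists t. repeat split; auto. intros u Hau. apply Hu; lra.
    - intros t Hat Htb. destruct (Rle_dec t b) as [Hle|Hle].
      + destruct (continuous_nonneg_lt f t c Hf ltac:(lra) (Htb Hle)) as [eta [He H]].
        exists eta; split; auto. intros u Hu _. apply H; [lra|].
        rewrite Rabs_pos_eq; lra.
      + exists 1; split; [lra|]. intros; lra. }
  specialize (H b Hab). lra.
Qed.

Lemma last_hit (f : R -> R) (a b c : R) :
  continuous_nonneg f -> 0 <= a -> a <= b -> c <= f a -> f b < c ->
  exists s, a <= s < b /\ f s = c /\ forall u, s < u <= b -> f u < c.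
Proof.
  intros Hf Ha Hab Hfa Hfb.
  (* Time is reversed from [b]; the absolute value keeps the argument in the domain where [f] is
     continuous, and equals [b - u] on the relevant range. *)
  destruct (first_hit (fun u => f (Rabs (b - u))) 0 (b - a) c) as [s [Hs [Hfs Hb]]].
  - intros t Ht eps Heps.
    destruct (Hf (Rabs (b - t)) (Rabs_pos _) eps Heps) as [d [Hd H]].
    exists d; split; auto. intros u Hu Hut. apply H; [apply Rabs_pos|].
    eapply Rle_lt_trans; [apply Rabs_triang_inv2|].
    replace (b - u - (b - t)) with (- (u - t)) by ring. now rewrite Rabs_Ropp.
  - lra.
  - lra.
  - rewrite Rminus_0_r, Rabs_pos_eq; lra.
  - replace (b - (b - a)) with a by ring. rewrite Rabs_pos_eq; lra.
  - simpl in Hfs, Hb. rewrite Rabs_pos_eq in Hfs by lra.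
    exists (b - s). repeat split; try lra; auto.
    intros u Hu. specialize (Hb (b - u) ltac:(lra)).
    replace (b - (b - u)) with u in Hb by ring. rewrite Rabs_pos_eq in Hb; lra.
Qed.

(** A mean value inequality. For each slope above [M] the bound passes to left limits by continuity
    and extends to the right by the derivative, so real induction applies; the slope then tends to
    [M]. *)
Lemma right_derivative_le (f g : R -> R) (a b M : R) :
  continuous_nonneg f -> right_derivative f g -> 0 <= a <= b ->
  (forall t, a <= t < b -> g t <= M) -> f b - f a <= M * (b - a).
Proof.
  intros Hc Hd Hab HM.
  assert (Heps : forall eps, 0 < eps -> f b - f a <= (M + eps) * (b - a)).
  { intros eps Heps.
    assert (H : forall t, a <= t -> t <= b -> f t - f a <= (M + eps) * (t - a)).
    { apply (real_induction (fun t => t <= b -> f t - f a <= (M + eps) * (t - a))).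
      - intros _. lra.
      - intros t Hat Hu Htb.
        enough (f t - (M + eps) * t <= f a - (M + eps) * a) by lra.
        apply (left_limit_le (fun t => f t - (M + eps) * t) a).
        + clear - Hc. intros t Ht e He.
          destruct (Hc t Ht (e / 2)) as [d [Hd H]]; [lra|].
          set (K := Rabs (M + eps) + 1).
          assert (HK : 0 < K) by (unfold K; pose proof (Rabs_pos (M + eps)); lra).
          exists (Rmin d (e / 2 / K)). split.
          { apply Rmin_glb_lt; auto. apply Rdiv_lt_0_compat; lra. }
          intros u Hu Hut.
          specialize (H u Hu ltac:(eapply Rlt_le_trans; [apply Hut|apply Rmin_l])).
          assert (Hut2 : Rabs (u - t) < e / 2 / K)
            by (eapply Rlt_le_trans; [apply Hut|apply Rmin_r]).
          replace (f u - (M + eps) * u - (f t - (M + eps) * t))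
            with ((f u - f t) + - ((M + eps) * (u - t))) by ring.
          eapply Rle_lt_trans; [apply Rabs_triang|].
          rewrite Rabs_Ropp, Rabs_mult.
          assert (Rabs (M + eps) * Rabs (u - t) <= e / 2); [|lra].
          apply Rle_trans with (K * (e / 2 / K)); [|right; field; lra].
          apply Rmult_le_compat; try apply Rabs_pos; unfold K in *; lra.
        + lra.
        + intros u Hau. specialize (Hu u Hau ltac:(lra)). lra.
      - intros t Hat HPt. destruct (Rlt_dec t b) as [Hlt|Hge].
        + destruct (Hd t ltac:(lra) eps Heps) as [d [Hd0 H]].
          exists d; split; auto. intros u Hu Hub.
          specialize (H (u - t) ltac:(lra)). specialize (HPt ltac:(lra)).
          specialize (HM t ltac:(lra)).
          replace (t + (u - t)) with u in H by ring.
          apply Rabs_def2 in H. destruct H as [H _].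
          assert (Hq : (f u - f t) / (u - t) < M + eps) by lra.
          apply (Rmult_lt_compat_r (u - t)) in Hq; [|lra].
          unfold Rdiv in Hq. rewrite Rmult_assoc, Rinv_l, Rmult_1_r in Hq by lra.
          lra.
        + exists 1; split; [lra|]. intros; lra. }
    apply H; lra. }
  apply Rnot_lt_le. intros Hlt.
  destruct (Req_dec a b) as [->|Hne]; [lra|].
  (* Half of the supposed excess slope. *)
  specialize (Heps ((f b - f a - M * (b - a)) / (2 * (b - a)))
    ltac:(apply Rdiv_lt_0_compat; lra)).
  rewrite Rmult_plus_distr_r in Heps.
  replace ((f b - f a - M * (b - a)) / (2 * (b - a)) * (b - a))
    with ((f b - f a - M * (b - a)) / 2) in Heps by (field; lra).
  lra.
Qed.

Lemma right_derivative_ge (f g : R -> R) (a b M : R) :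
  continuous_nonneg f -> right_derivative f g -> 0 <= a <= b ->
  (forall t, a <= t < b -> M <= g t) -> M * (b - a) <= f b - f a.
Proof.
  intros Hc Hd Hab HM.
  pose proof (right_derivative_le (fun t => - f t) (fun t => - g t) a b (- M)
    (continuous_nonneg_opp f Hc) (right_derivative_opp f g Hd) Hab) as H.
  simpl in H. enough (- f b - - f a <= - M * (b - a)) by lra.
  apply H. intros t Ht. specialize (HM t Ht). lra.
Qed.

Lemma right_derivative_const (f g : R -> R) (a b c : R) :
  continuous_nonneg f -> right_derivative f g -> 0 <= a <= b ->
  (forall t, a <= t < b -> g t = c) -> f b = f a + c * (b - a).
Proof.
  intros Hc Hd Hab Hg.
  pose proof (right_derivative_le f g a b c Hc Hd Hab
    ltac:(intros t Ht; rewrite (Hg t Ht); lra)).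
  pose proof (right_derivative_ge f g a b c Hc Hd Hab
    ltac:(intros t Ht; rewrite (Hg t Ht); lra)).
  lra.
Qed.

(** * Uniform choices over finitely many indices *)

Lemma uniform_pos (P : nat -> R -> Prop) (n : nat) :
  (forall j e e', P j e -> 0 < e' <= e -> P j e') ->
  (forall j, (j < n)%nat -> exists e, 0 < e /\ P j e) ->
  exists e, 0 < e /\ forall j, (j < n)%nat -> P j e.
Proof.
  intros Hdown. induction n as [|n IH]; intros H.
  - exists 1; split; [lra|]. intros; lia.
  - destruct IH as [e [He HP]]; [intros; apply H; lia|].
    destruct (H n ltac:(lia)) as [e' [He' HP']].
    exists (Rmin e e'). split; [now apply Rmin_glb_lt|].
    intros j Hj. destruct (Nat.eq_dec j n) as [->|Hne].
    + apply Hdown with e'; auto. split; [now apply Rmin_glb_lt|apply Rmin_r].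
    + apply Hdown with e; [apply HP; lia|]. split; [now apply Rmin_glb_lt|apply Rmin_l].
Qed.

Lemma uniform_nat (P : nat -> nat -> Prop) (n : nat) :
  (forall j m m', P j m -> (m <= m')%nat -> P j m') ->
  (forall j, (j < n)%nat -> exists m, P j m) ->
  exists m, forall j, (j < n)%nat -> P j m.
Proof.
  intros Hup. induction n as [|n IH]; intros H.
  - exists 0%nat. intros; lia.
  - destruct IH as [m HP]; [intros; apply H; lia|].
    destruct (H n ltac:(lia)) as [m' HP'].
    exists (Nat.max m m'). intros j Hj. destruct (Nat.eq_dec j n) as [->|Hne].
    + apply Hup with m'; auto; lia.
    + apply Hup with m; [apply HP|]; lia.
Qed.

(** * Phases modulo 2π *)

Lemma mod2pi_spec (x : R) :
  0 <= mod2pi x < 2 * PI /\ exists k : Z, x = mod2pi x + 2 * PI * IZR k.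
Proof.
  pose proof PI_RGT_0 as Hpi. unfold mod2pi.
  destruct (base_Int_part (x / (2 * PI))) as [H1 H2].
  set (k := Int_part (x / (2 * PI))) in *.
  assert (Hx : x = 2 * PI * (x / (2 * PI))) by (field; lra).
  split; [|exists k; ring].
  set (y := x / (2 * PI)) in *. rewrite Hx. split.
  - enough (0 <= 2 * PI * (y - IZR k)) by lra. apply Rmult_le_pos; lra.
  - assert (2 * PI * (y - IZR k) < 2 * PI * 1); [|lra].
    apply Rmult_lt_compat_l; lra.
Qed.

Lemma IZR_lt_of_2pi (k l : Z) : 2 * PI * IZR k < 2 * PI * IZR l + 2 * PI -> (k <= l)%Z.
Proof.
  pose proof PI_RGT_0. intros Hlt.
  assert (IZR k < IZR (l + 1)).
  { apply Rmult_lt_reg_l with (2 * PI); [lra|]. rewrite plus_IZR. lra. }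
  apply lt_IZR in H0. lia.
Qed.

Lemma IZR_2pi_le (k l : Z) : (k <= l)%Z -> 2 * PI * IZR k <= 2 * PI * IZR l.
Proof.
  pose proof PI_RGT_0. intros Hle. apply IZR_le in Hle.
  apply Rmult_le_compat_l; lra.
Qed.

Lemma mod2pi_eq (x : R) (k : Z) :
  0 <= x - 2 * PI * IZR k < 2 * PI -> mod2pi x = x - 2 * PI * IZR k.
Proof.
  intros Hk. destruct (mod2pi_spec x) as [Hm [l Hl]].
  assert (k <= l)%Z by (apply IZR_lt_of_2pi; lra).
  assert (l <= k)%Z by (apply IZR_lt_of_2pi; lra).
  replace k with l by lia. lra.
Qed.

Lemma mod2pi_shift (x : R) (n : Z) : mod2pi (x + 2 * PI * IZR n) = mod2pi x.
Proof.
  destruct (mod2pi_spec x) as [Hm [k Hk]].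
  rewrite (mod2pi_eq (x + 2 * PI * IZR n) (k + n)); rewrite plus_IZR; lra.
Qed.

(** [Q] is the signed displacement to the nearest multiple of 2π; its two branches correspond to
    that multiple lying below or above [y]. *)
Lemma Q_mod2pi (y : R) (k : Z) :
  - PI < 2 * PI * IZR k - y < PI -> Q (mod2pi y) = 2 * PI * IZR k - y.
Proof.
  pose proof PI_RGT_0. intros Hy. unfold Q.
  destruct (Rle_dec (2 * PI * IZR k) y).
  - rewrite (mod2pi_eq y k) by lra. destruct Rle_dec; lra.
  - rewrite (mod2pi_eq y (k - 1)) by (rewrite minus_IZR; lra).
    rewrite minus_IZR. destruct Rle_dec; lra.
Qed.

(** * Executions *)

(* [move x g d] is the position reached from [x] after a displacement of at most [d] towards [g]. *)
Definition move (x g d : R) : R := Rmax (x - d) (Rmin (x + d) g).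

Ltac minmax := unfold move, Rmax, Rmin in *; repeat destruct Rle_dec; try lra.

Lemma move_move (x g d e : R) :
  0 <= d -> 0 <= e -> move (move x g d) g e = move x g (d + e).
Proof. intros. minmax. Qed.

Section Execution.

Context (N : nat) (adj : nat -> nat -> Prop) (w0 wmax alpha D : R)
  (theta0 : nat -> R) (Phi om : nat -> R -> R)
  (Hw0 : 0 < w0) (Hwmax : 0 < wmax) (Halpha : 0 < alpha <= 1)
  (Hexec : is_execution N adj w0 wmax alpha D theta0 Phi om).

Local Notation recv := (receives N adj D Phi).

Definition lifted_heading (i : nat) (t : R) : R := Phi i t - w0 * t.

Local Notation X := lifted_heading.

(** Mirrors the two cases of the rate clause. Before any pulse the target is the initial heading, so
    the robot rests on it; a target stays in force after it has been reached. *)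
Definition is_target (i : nat) (t g : R) : Prop :=
  ((forall s, 0 <= s <= t -> ~ recv i s) /\ g = X i 0) \/
  (exists s, 0 <= s <= t /\ recv i s /\ (forall u, s < u <= t -> ~ recv i u) /\
     g = X i s + alpha * Q (phase Phi i s)).

(* The heading that robot [i] is steering to at time [t]. *)
Definition target (i : nat) (t : R) : R := epsilon (inhabits 0) (is_target i t).

Local Notation G := target.

Lemma phase_continuous (i : nat) : (i < N)%nat -> continuous_nonneg (Phi i).
Proof. intros Hi. exact (proj1 (proj2 (Hexec i Hi))). Qed.

Lemma phase_derivative (i : nat) : (i < N)%nat -> right_derivative (Phi i) (om i).
Proof. intros Hi. exact (proj1 (proj2 (proj2 (Hexec i Hi)))). Qed.

Lemma rate_cases (i : nat) (t : R) : (i < N)%nat -> 0 <= t ->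
  ((forall s, 0 <= s <= t -> ~ recv i s) /\ om i t = w0) \/
  (exists s, 0 <= s <= t /\ recv i s /\ (forall u, s < u <= t -> ~ recv i u) /\
     om i t = rate_after w0 wmax (alpha * Q (phase Phi i s)) s t).
Proof. intros Hi. exact (proj2 (proj2 (proj2 (Hexec i Hi))) t). Qed.

Lemma target_spec (i : nat) (t : R) : (i < N)%nat -> 0 <= t -> is_target i t (G i t).
Proof.
  intros Hi Ht. unfold target. apply epsilon_spec.
  destruct (rate_cases i t Hi Ht) as [[H _]|[s [Hs [Hr [H _]]]]].
  - exists (X i 0). left; auto.
  - exists (X i s + alpha * Q (phase Phi i s)). right. exists s; auto.
Qed.

Lemma last_recv_unique (i : nat) (s s' t : R) :
  s <= t -> s' <= t -> recv i s -> recv i s' ->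
  (forall u, s < u <= t -> ~ recv i u) -> (forall u, s' < u <= t -> ~ recv i u) -> s = s'.
Proof.
  intros Hs Hs' Hr Hr' Hl Hl'.
  destruct (Rtotal_order s s') as [H|[H|H]]; auto; exfalso.
  - apply (Hl s'); auto.
  - apply (Hl' s); auto.
Qed.

Lemma target_after_recv (i : nat) (s t : R) :
  (i < N)%nat -> 0 <= s <= t -> recv i s -> (forall u, s < u <= t -> ~ recv i u) ->
  G i t = X i s + alpha * Q (phase Phi i s).
Proof.
  intros Hi Hst Hr Hl.
  destruct (target_spec i t Hi ltac:(lra)) as [[H _]|[s' [Hs' [Hr' [Hl' ->]]]]].
  - exfalso; apply (H s); auto.
  - now rewrite (last_recv_unique i s s' t) by (auto; lra).
Qed.

Lemma rate_after_recv (i : nat) (s t : R) :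
  (i < N)%nat -> 0 <= s <= t -> recv i s -> (forall u, s < u <= t -> ~ recv i u) ->
  om i t = rate_after w0 wmax (alpha * Q (phase Phi i s)) s t.
Proof.
  intros Hi Hst Hr Hl.
  destruct (rate_cases i t Hi ltac:(lra)) as [[H _]|[s' [Hs' [Hr' [Hl' ->]]]]].
  - exfalso; apply (H s); auto.
  - now rewrite (last_recv_unique i s s' t) by (auto; lra).
Qed.

Lemma rate_bound (i : nat) (t : R) :
  (i < N)%nat -> 0 <= t -> w0 - wmax <= om i t <= w0 + wmax.
Proof.
  intros Hi Ht.
  destruct (rate_cases i t Hi Ht) as [[_ ->]|[s [_ [_ [_ ->]]]]]; [lra|].
  unfold rate_after. repeat destruct Rlt_dec; lra.
Qed.

Lemma heading_rate (i : nat) (s t : R) :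
  (i < N)%nat -> 0 <= s <= t -> Rabs (X i t - X i s) <= wmax * (t - s).
Proof.
  intros Hi Hst. unfold lifted_heading.
  pose proof (right_derivative_le (Phi i) (om i) s t (w0 + wmax) (phase_continuous i Hi)
    (phase_derivative i Hi) Hst ltac:(intros u Hu; apply rate_bound; auto; lra)).
  pose proof (right_derivative_ge (Phi i) (om i) s t (w0 - wmax) (phase_continuous i Hi)
    (phase_derivative i Hi) Hst ltac:(intros u Hu; apply rate_bound; auto; lra)).
  apply Rabs_le. lra.
Qed.

Lemma heading_continuous (i : nat) : (i < N)%nat -> continuous_nonneg (X i).
Proof.
  intros Hi t Ht eps Heps. exists (eps / wmax). split; [apply Rdiv_lt_0_compat; lra|].
  intros u Hu Hut. apply (Rmult_lt_compat_l wmax) in Hut; [|lra].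
  replace (wmax * (eps / wmax)) with eps in Hut by (field; lra).
  destruct (Rle_dec u t) as [Hle|Hle].
  - pose proof (heading_rate i u t Hi ltac:(lra)).
    rewrite Rabs_minus_sym in H. rewrite Rabs_minus_sym, Rabs_pos_eq in Hut by lra. lra.
  - pose proof (heading_rate i t u Hi ltac:(lra)). rewrite Rabs_pos_eq in Hut by lra. lra.
Qed.

Lemma constant_rate (i : nat) (a b c : R) :
  (i < N)%nat -> 0 <= a <= b -> (forall t, a <= t < b -> om i t = w0 + c) ->
  X i b = X i a + c * (b - a).
Proof.
  intros Hi Hab Hc. unfold lifted_heading.
  rewrite (right_derivative_const (Phi i) (om i) a b (w0 + c)); auto.
  - ring.
  - now apply phase_continuous.
  - now apply phase_derivative.
Qed.

(** The duration |psi|/wmax is exactly the time needed to cover |psi| at speed [wmax], so the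
    heading stops on its target, which is what [move] expresses. *)
Lemma heading_after_recv (i : nat) (s t : R) :
  (i < N)%nat -> 0 <= s <= t -> recv i s -> (forall u, s < u <= t -> ~ recv i u) ->
  X i t = move (X i s) (X i s + alpha * Q (phase Phi i s)) (wmax * (t - s)).
Proof.
  intros Hi Hst Hr Hl.
  assert (Hom : forall u, s <= u < t ->
    om i u = rate_after w0 wmax (alpha * Q (phase Phi i s)) s u).
  { intros u Hu. apply rate_after_recv; auto; [lra|]. intros v Hv. apply Hl; lra. }
  set (psi := alpha * Q (phase Phi i s)) in *. unfold rate_after in Hom.
  assert (Hcancel : forall y, wmax * (y / wmax) = y) by (intros; field; lra).
  assert (Hd : 0 <= wmax * (t - s)) by (apply Rmult_le_pos; lra).
  destruct (Rlt_dec 0 psi) as [Hpos|Hpos]; [|destruct (Rlt_dec psi 0) as [Hneg|Hneg]].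
  - pose proof (Hcancel psi) as Hp.
    assert (0 < psi / wmax) by (apply Rdiv_lt_0_compat; lra).
    destruct (Rle_dec t (s + psi / wmax)) as [Hle|Hle].
    + rewrite (constant_rate i s t wmax); auto.
      * assert (wmax * (t - s) <= wmax * (psi / wmax)) by (apply Rmult_le_compat_l; lra).
        minmax.
      * intros u Hu. rewrite Hom by auto. destruct Rlt_dec; lra.
    + rewrite (constant_rate i (s + psi / wmax) t 0); auto; [|lra|].
      * rewrite (constant_rate i s (s + psi / wmax) wmax); auto; [|lra|].
        -- assert (wmax * (psi / wmax) <= wmax * (t - s)) by (apply Rmult_le_compat_l; lra).
           replace (s + psi / wmax - s) with (psi / wmax) by ring. minmax.
        -- intros u Hu. rewrite Hom by lra. destruct Rlt_dec; lra.
      * intros u Hu. rewrite Hom by lra. destruct Rlt_dec; lra.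
  - pose proof (Hcancel (- psi)) as Hp.
    assert (0 < - psi / wmax) by (apply Rdiv_lt_0_compat; lra).
    destruct (Rle_dec t (s + - psi / wmax)) as [Hle|Hle].
    + rewrite (constant_rate i s t (- wmax)); auto.
      * assert (wmax * (t - s) <= wmax * (- psi / wmax)) by (apply Rmult_le_compat_l; lra).
        minmax.
      * intros u Hu. rewrite Hom by auto. destruct Rlt_dec; lra.
    + rewrite (constant_rate i (s + - psi / wmax) t 0); auto; [|lra|].
      * rewrite (constant_rate i s (s + - psi / wmax) (- wmax)); auto; [|lra|].
        -- assert (wmax * (- psi / wmax) <= wmax * (t - s)) by (apply Rmult_le_compat_l; lra).
           replace (s + - psi / wmax - s) with (- psi / wmax) by ring. minmax.
        -- intros u Hu. rewrite Hom by lra. destruct Rlt_dec; lra.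
      * intros u Hu. rewrite Hom by lra. destruct Rlt_dec; lra.
  - rewrite (constant_rate i s t 0); auto; [minmax|].
    intros u Hu. rewrite Hom by auto. lra.
Qed.

(** The motion towards a target can be restarted at any time [a], not only at the pulse that set the
    target, by the semigroup law [move_move]. *)
Lemma flow (i : nat) (a b : R) :
  (i < N)%nat -> 0 <= a <= b -> (forall u, a < u <= b -> ~ recv i u) ->
  G i b = G i a /\ X i b = move (X i a) (G i a) (wmax * (b - a)).
Proof.
  intros Hi Hab Hno.
  destruct (target_spec i a Hi ltac:(lra)) as [[Hn Hg]|[s [Hs [Hr [Hl Hg]]]]].
  - assert (Hn' : forall s, 0 <= s <= b -> ~ recv i s).
    { intros s Hs. destruct (Rle_dec s a); [apply Hn|apply Hno]; lra. }
    assert (HX : forall t, 0 <= t <= b -> X i t = X i 0).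
    { intros t Ht. rewrite (constant_rate i 0 t 0); auto; [ring|lra|].
      intros u Hu. destruct (rate_cases i u Hi ltac:(lra)) as [[_ ->]|[s [Hs [Hr _]]]]; [lra|].
      exfalso; apply (Hn' s); auto; lra. }
    rewrite Hg, (HX a), (HX b) by lra. split.
    + destruct (target_spec i b Hi ltac:(lra)) as [[_ Hg']|[s [Hs [Hr _]]]]; auto.
      exfalso; apply (Hn' s); auto.
    + assert (0 <= wmax * (b - a)) by (apply Rmult_le_pos; lra). minmax.
  - assert (Hl' : forall u, s < u <= b -> ~ recv i u).
    { intros u Hu. destruct (Rle_dec u a); [apply Hl|apply Hno]; lra. }
    rewrite Hg. split; [now apply target_after_recv; auto; lra|].
    rewrite (heading_after_recv i s b), (heading_after_recv i s a) by (auto; lra).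
    rewrite move_move by (apply Rmult_le_pos; lra).
    f_equal; ring.
Qed.

Lemma last_recv (i : nat) (t : R) : (i < N)%nat -> 0 <= t ->
  (forall u, 0 <= u <= t -> ~ recv i u) \/
  exists s, 0 <= s <= t /\ recv i s /\ forall u, s < u <= t -> ~ recv i u.
Proof.
  intros Hi Ht. destruct (rate_cases i t Hi Ht) as [[H _]|[s [Hs [Hr [Hl _]]]]]; eauto.
Qed.

(** Pulses cannot accumulate at [t] from the left, because the rate clause supplies a last pulse
    received up to [t]. *)
Lemma no_recv_left (i : nat) (a t : R) : (i < N)%nat -> 0 <= a < t -> ~ recv i t ->
  exists u, a <= u < t /\ forall v, u < v <= t -> ~ recv i v.
Proof.
  intros Hi Hat Hn. destruct (last_recv i t Hi ltac:(lra)) as [H|[s [Hs [Hr Hl]]]].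
  - exists a. split; [lra|]. intros v Hv. apply H; lra.
  - assert (s <> t) by (intros ->; auto).
    exists (Rmax a s). split; [minmax|]. intros v Hv. apply Hl. minmax.
Qed.

(* A backward turn starts at a phase in (0, π] and aims at most at phase 0, so even when
   wmax > w0 it cannot undo a crossing of a multiple of 2π. *)
Lemma no_return (i : nat) (k : Z) (s t : R) :
  (i < N)%nat -> 0 <= s <= t -> 2 * PI * IZR k <= Phi i s -> 2 * PI * IZR k <= Phi i t.
Proof.
  intros Hi Hst Hs. apply Rnot_lt_le; intros Ht. pose proof PI_RGT_0 as Hpi.
  set (c := 2 * PI * IZR k) in *.
  pose proof (phase_continuous i Hi) as Hcont.
  destruct (last_hit (Phi i) s t c) as [s1 [Hs1 [Hc Hafter]]]; auto; try lra.
  destruct (Hcont s1 ltac:(lra) PI Hpi) as [d [Hd Hclose]].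
  set (t1 := Rmin t (s1 + d / 2)).
  assert (Ht1 : s1 < t1 /\ t1 <= t /\ t1 < s1 + d) by (unfold t1; minmax).
  assert (Hwin : forall u, s1 < u <= t1 -> c - PI < Phi i u < c).
  { intros u Hu. split; [|apply Hafter; lra].
    specialize (Hclose u ltac:(lra) ltac:(apply Rabs_def1; lra)).
    apply Rabs_def2 in Hclose. lra. }
  (* It suffices that no rate on this window is negative. A rate set at [q >= s1] was computed at
     the level or just below it, where [Q] is nonnegative. *)
  assert (Hge : 0 * (t1 - s1) <= Phi i t1 - Phi i s1).
  { apply (right_derivative_ge _ (om i)); auto; [now apply phase_derivative|lra|].
    intros r Hr.
    destruct (rate_cases i r Hi ltac:(lra)) as [[_ ->]|[q [Hq [Hrq [Hl ->]]]]]; [lra|].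
    destruct (Rle_dec s1 q) as [Hle|Hlt].
    - assert (HQ : 0 <= alpha * Q (phase Phi i q)).
      { apply Rmult_le_pos; [lra|]. unfold phase.
        assert (c - PI < Phi i q <= c).
        { destruct (Req_dec q s1) as [->|Hne]; [lra|]. specialize (Hwin q ltac:(lra)). lra. }
        rewrite (Q_mod2pi _ k); fold c; lra. }
      unfold rate_after. repeat destruct Rlt_dec; lra.
    (* Here the rate was set before [s1]. If it is negative, a backward turn is still unfinished at
       [s1], so [Phi i s1] lies strictly between [Phi i q] and the multiple of 2π just below
       [Phi i q], and cannot equal [c]. *)
    - unfold rate_after.
      destruct Rlt_dec as [|_]; [destruct Rlt_dec; lra|].
      destruct Rlt_dec as [Hneg|_]; [|lra].
      destruct Rlt_dec as [Hr'|_]; [|lra].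
      destruct (Rle_dec wmax w0) as [|Hw]; [lra|exfalso].
      pose proof (heading_after_recv i q s1 Hi ltac:(lra) Hrq
        ltac:(intros u Hu; apply Hl; lra)) as HX.
      set (psi := alpha * Q (phase Phi i q)) in *.
      assert (Hd1 : wmax * (s1 - q) < - psi).
      { replace (- psi) with (wmax * (- psi / wmax)) by (field; lra).
        apply Rmult_lt_compat_l; lra. }
      assert (Hd0 : w0 * (s1 - q) < wmax * (s1 - q)) by (apply Rmult_lt_compat_r; lra).
      assert (Hd2 : 0 < w0 * (s1 - q)) by (apply Rmult_lt_0_compat; lra).
      destruct (mod2pi_spec (Phi i q)) as [Hm [l Hml]].
      fold (phase Phi i q) in Hm, Hml.
      assert (Hphi : phase Phi i q <= PI /\ - phase Phi i q <= psi).
      { unfold psi, Q in *. destruct Rle_dec as [Hpi1|Hpi1].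
        - split; auto.
          assert (alpha * phase Phi i q <= 1 * phase Phi i q)
            by (apply Rmult_le_compat_r; lra). lra.
        - assert (0 < alpha * (2 * PI - phase Phi i q)) by (apply Rmult_lt_0_compat; lra).
          lra. }
      assert (HX' : Phi i s1 = Phi i q + w0 * (s1 - q) - wmax * (s1 - q)).
      { unfold lifted_heading in HX.
        assert (Phi i s1 - w0 * s1 = Phi i q - w0 * q - wmax * (s1 - q)); [|lra].
        rewrite HX. minmax. }
      assert (k <= l)%Z by (apply IZR_lt_of_2pi; fold c; lra).
      pose proof (IZR_2pi_le k l H). fold c in H0. lra. }
  specialize (Hwin t1 ltac:(lra)). lra.
Qed.

(** * Discreteness of the firing times *)

(** By [no_return], a robot that had reached the level earlier would stay at or above it, against
    the approach from below required by [fires]. Hence a robot fires at most once per level. *)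
Lemma fires_first (j : nat) (s u : R) (k : Z) :
  (j < N)%nat -> 0 <= u < s -> Phi j s = 2 * PI * IZR k -> fires Phi j s ->
  Phi j u < 2 * PI * IZR k.
Proof.
  intros Hj Hus Hk [_ [l [Hl [e [He Hbefore]]]]].
  apply Rnot_le_lt. intros Hle. rewrite Hk in Hl. rewrite <- Hl in Hbefore.
  set (v := Rmax u (s - e / 2)).
  assert (Hv : u <= v /\ s - e < v < s) by (unfold v; minmax).
  specialize (Hbefore v ltac:(lra)).
  pose proof (no_return j k u v Hj ltac:(lra) Hle). lra.
Qed.

(** Just after [t] the next level is still out of reach by continuity, and the levels already
    reached cannot fire again by [fires_first]. *)
Lemma fires_discrete (t : R) : 0 <= t ->
  exists eta, 0 < eta /\ forall j, (j < N)%nat -> forall u, t < u < t + eta -> ~ fires Phi j u.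
Proof.
  intros Ht.
  apply (uniform_pos (fun j eta => forall u, t < u < t + eta -> ~ fires Phi j u)).
  - intros j e e' H He u Hu. apply H; lra.
  - intros j Hj. destruct (mod2pi_spec (Phi j t)) as [Hm [k Hk]].
    destruct (continuous_nonneg_lt (Phi j) t (2 * PI * IZR (k + 1)))
      as [eta [Heta H]]; auto; [now apply phase_continuous|rewrite plus_IZR; lra|].
    exists eta; split; auto. intros u Hu Hf.
    assert (Hf' := Hf). destruct Hf' as [_ [l [Hl _]]].
    pose proof (fires_first j u t l Hj ltac:(lra) Hl Hf) as Hlt.
    specialize (H u ltac:(lra) ltac:(apply Rabs_def1; lra)).
    rewrite Hl, plus_IZR in H.
    assert (l <= k)%Z by (apply IZR_lt_of_2pi; lra).
    pose proof (IZR_2pi_le l k H0). lra.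
Qed.

Lemma recv_discrete (t : R) : 0 <= t ->
  exists eta, 0 < eta /\ forall i u, t < u < t + eta -> ~ recv i u.
Proof.
  intros Ht. destruct (fires_discrete t Ht) as [eta [He H]].
  exists eta; split; auto. intros i u Hu [[j [Hj [_ Hf]]] _]. apply (H j Hj u Hu Hf).
Qed.

(** * Bounds on headings and targets propagated through pulses *)

(** Between pulses a heading moves inside the segment from itself to its target, so only the new
    targets have to be checked. [J] allows the claim for all robots or for a single one. *)
Lemma invariant_interval (J : nat -> Prop) (lo hi a b : R) :
  0 <= a ->
  (forall i, (i < N)%nat -> J i -> lo <= X i a <= hi /\ lo <= G i a <= hi) ->
  (forall t, a < t <= b -> (forall i, (i < N)%nat -> J i -> lo <= X i t <= hi) ->
     forall i, (i < N)%nat -> J i -> recv i t -> lo <= G i t <= hi) ->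
  forall t, a <= t <= b -> forall i, (i < N)%nat -> J i ->
    lo <= X i t <= hi /\ lo <= G i t <= hi.
Proof.
  intros Ha H0 Hjump t Ht.
  revert t Ht.
  enough (H : forall t, a <= t -> t <= b -> forall i, (i < N)%nat -> J i ->
    lo <= X i t <= hi /\ lo <= G i t <= hi) by (intros t Ht; apply H; lra).
  apply (real_induction (fun t => t <= b -> forall i, (i < N)%nat -> J i ->
    lo <= X i t <= hi /\ lo <= G i t <= hi)).
  - intros _. exact H0.
  - intros t Hat Hbefore Htb.
    assert (HX : forall i, (i < N)%nat -> J i -> lo <= X i t <= hi).
    { intros i Hi HJ. split.
      - enough (- X i t <= - lo) by lra.
        apply (left_limit_le (fun u => - X i u) a); [|lra|].
        + now apply continuous_nonneg_opp, heading_continuous.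
        + intros u Hu. destruct (Hbefore u Hu ltac:(lra) i Hi HJ). lra.
      - apply (left_limit_le (X i) a); [now apply heading_continuous|lra|].
        intros u Hu. destruct (Hbefore u Hu ltac:(lra) i Hi HJ). lra. }
    intros i Hi HJ. split; auto.
    destruct (classic (recv i t)) as [Hr|Hr]; [apply Hjump; auto|].
    destruct (no_recv_left i a t Hi ltac:(lra) Hr) as [u [Hu Hno]].
    destruct (flow i u t Hi ltac:(lra) Hno) as [-> _].
    destruct (Hbefore u Hu ltac:(lra) i Hi HJ). lra.
  - intros t Hat Ht. destruct (recv_discrete t ltac:(lra)) as [eta [Heta Hno]].
    exists eta; split; auto. intros u Hu Hub i Hi HJ.
    destruct (Ht ltac:(lra) i Hi HJ) as [HX HG].
    destruct (flow i t u Hi ltac:(lra) ltac:(intros v Hv; apply Hno; lra)) as [-> ->].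
    assert (0 <= wmax * (u - t)) by (apply Rmult_le_pos; lra).
    split; auto. minmax.
Qed.

(** The target may change along the way; as long as it stays above [g], a robot below [g] rises at
    full speed and one above [g] cannot fall below it. *)
Lemma chase (i : nat) (g a b : R) :
  (i < N)%nat -> 0 <= a <= b -> (forall t, a <= t <= b -> g <= G i t) ->
  Rmin g (X i a + wmax * (b - a)) <= X i b.
Proof.
  intros Hi Hab Hg.
  enough (H : forall t, a <= t -> t <= b -> Rmin g (X i a + wmax * (t - a)) <= X i t)
    by (apply H; lra).
  apply (real_induction (fun t => t <= b -> Rmin g (X i a + wmax * (t - a)) <= X i t)).
  - intros _. minmax.
  - intros t Hat Hbefore Htb.
    apply Rnot_lt_le. intros Hlt.
    (* A deficit [e] cannot appear within time e/(4 wmax): the heading and the bound each move by at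
       most e/4. *)
    set (e := Rmin g (X i a + wmax * (t - a)) - X i t) in *.
    assert (He : 0 < e) by (unfold e; lra).
    set (u := Rmax a (t - e / (4 * wmax))).
    assert (0 < e / (4 * wmax)) by (apply Rdiv_lt_0_compat; lra).
    assert (Hu : a <= u < t /\ t - u <= e / (4 * wmax)) by (unfold u; minmax).
    assert (Hd : wmax * (t - u) <= e / 4).
    { replace (e / 4) with (wmax * (e / (4 * wmax))) by (field; lra).
      apply Rmult_le_compat_l; lra. }
    pose proof (heading_rate i u t Hi ltac:(lra)) as Hr.
    pose proof (Rle_abs (- (X i t - X i u))) as Hr'. rewrite Rabs_Ropp in Hr'.
    specialize (Hbefore u ltac:(lra) ltac:(lra)).
    assert (wmax * (t - a) = wmax * (t - u) + wmax * (u - a)) by ring.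
    unfold e in *. minmax.
  - intros t Hat Ht. destruct (recv_discrete t ltac:(lra)) as [eta [Heta Hno]].
    exists eta; split; auto. intros u Hu Hub. specialize (Ht ltac:(lra)).
    destruct (flow i t u Hi ltac:(lra) ltac:(intros v Hv; apply Hno; lra)) as [_ ->].
    specialize (Hg t ltac:(lra)).
    assert (0 <= wmax * (u - t)) by (apply Rmult_le_pos; lra).
    assert (wmax * (u - a) = wmax * (u - t) + wmax * (t - a)) by ring.
    minmax.
Qed.

Lemma convex_bounds (a lo hi x y : R) :
  0 <= a <= 1 -> lo <= x <= hi -> lo <= y <= hi -> lo <= x + a * (y - x) <= hi.
Proof.
  intros Ha Hx Hy. replace (x + a * (y - x)) with ((1 - a) * x + a * y) by ring.
  assert ((1 - a) * lo <= (1 - a) * x <= (1 - a) * hi)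
    by (split; apply Rmult_le_compat_l; lra).
  assert (a * lo <= a * y <= a * hi) by (split; apply Rmult_le_compat_l; lra).
  lra.
Qed.

Definition in_band (t lo hi : R) : Prop :=
  forall i, (i < N)%nat -> lo <= X i t <= hi /\ lo <= G i t <= hi.

(** The band is narrower than π, so the multiple of 2π nearest to the receiver's phase is the level
    at which the sender fires. The adjustment is then [alpha] times the difference of the two lifted
    headings. *)
Lemma target_at_recv (i : nat) (t lo hi : R) :
  hi - lo < PI -> (i < N)%nat -> 0 <= t -> (forall j, (j < N)%nat -> lo <= X j t <= hi) ->
  recv i t ->
  exists j k, (j < N)%nat /\ fires Phi j t /\ Phi j t = 2 * PI * IZR k /\
    G i t = X i t + alpha * (X j t - X i t).
Proof.
  intros Hw Hi Ht Hband Hr. assert (Hr' := Hr).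
  destruct Hr' as [[j [Hj [_ Hf]]] _]. assert (Hf' := Hf). destruct Hf' as [_ [k [Hk _]]].
  exists j, k. do 3 (split; auto).
  rewrite (target_after_recv i t t) by (auto; try lra; intros; lra).
  pose proof (Hband i Hi). pose proof (Hband j Hj).
  unfold phase. rewrite (Q_mod2pi _ k); unfold lifted_heading in *; rewrite Hk in *.
  - do 2 f_equal. ring.
  - lra.
Qed.

Lemma band_invariant (lo hi s t : R) :
  hi - lo < PI -> 0 <= s <= t -> in_band s lo hi -> in_band t lo hi.
Proof.
  intros Hw Hst Hs i Hi.
  apply (invariant_interval (fun _ => True) lo hi s t); auto; try lra.
  intros u Hu HX j Hj _ Hr.
  assert (HX' : forall l, (l < N)%nat -> lo <= X l u <= hi) by auto.
  destruct (target_at_recv j u lo hi Hw Hj ltac:(lra) HX' Hr) as [l [k [Hl [_ [_ ->]]]]].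
  apply convex_bounds; auto; lra.
Qed.

Lemma initial_band (lo hi : R) :
  (forall i, (i < N)%nat -> lo <= theta0 i <= hi) -> in_band 0 lo hi.
Proof.
  intros H i Hi.
  assert (HX : X i 0 = theta0 i).
  { unfold lifted_heading. rewrite (proj1 (Hexec i Hi)). ring. }
  (* [fires] demands a positive time, so no pulse is received at time 0. *)
  destruct (target_spec i 0 Hi ltac:(lra)) as [[_ ->]|[s [Hs [[[j [_ [_ [Hf _]]]] _] _]]]].
  - rewrite HX. auto.
  - lra.
Qed.

Context (Lbar : R) (HD : 0 <= D < 2 * PI) (HLbar : 0 < Lbar <= PI) (HDL : D <= 2 * PI - Lbar).

(** * Reachability in a bounded number of hops *)

(** Cumulative in [m], so that one bound serves all pairs; the recursion peels off the last edge, as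
    the induction in [crossing_level] needs. *)
Fixpoint within (m i j : nat) : Prop :=
  match m with
  | O => i = j
  | S m' => within m' i j \/ exists l, within m' i l /\ edge_in N adj l j
  end.

Lemma within_le (m m' i j : nat) : (m <= m')%nat -> within m i j -> within m' i j.
Proof. induction 1; simpl; auto. Qed.

Lemma within_uniform : strongly_connected N adj ->
  exists K, forall i, (i < N)%nat -> forall j, (j < N)%nat -> within K i j.
Proof.
  intros Hconn.
  apply (uniform_nat (fun i m => forall j, (j < N)%nat -> within m i j)).
  - intros i m m' H Hm j Hj. apply within_le with m; auto.
  - intros i Hi. apply (uniform_nat (fun j m => within m i j)).
    + intros j m m' H Hm. now apply within_le with m.
    + intros j Hj. pose proof (Hconn i j Hi Hj) as H.
      apply clos_rt_rtn1 in H. induction H as [|y z Hyz _ IH].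
      * now exists 0%nat.
      * destruct IH as [m Hm]; [exact (proj1 Hyz)|].
        exists (S m). right. exists y; auto.
Qed.

(** * Sweeps of the firing level *)

Section Passes.

(** After [T] all headings and targets lie within [eps] of [A, B]. The second margin [eps] on each
    side makes a pass begin and end strictly outside this band, and the width bound leaves a quiet
    period between passes. *)
Context (A B eps T : R) (HAB : A <= B) (Heps : 0 < eps) (Hwidth : B - A + 4 * eps <= Lbar)
  (HT : 0 <= T) (Hband : forall t, T <= t -> in_band t (A - eps) (B + eps)).

(* In the coordinate of the lifted headings, robot [i] fires when its heading meets the level
   2πk - w0 t, which descends at speed w0 through the band during the [k]-th pass. *)
Definition pass_start (k : Z) : R := (2 * PI * IZR k - (B + 2 * eps)) / w0.

Definition pass_end (k : Z) : R := (2 * PI * IZR k - (A - 2 * eps)) / w0.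

Definition crosses (i : nat) (k : Z) (tau : R) : Prop :=
  pass_start k < tau < pass_end k /\ Phi i tau = 2 * PI * IZR k /\
  forall u, pass_start k <= u < tau -> Phi i u < 2 * PI * IZR k.

Lemma w0_pass_start (k : Z) : w0 * pass_start k = 2 * PI * IZR k - (B + 2 * eps).
Proof. unfold pass_start; field; lra. Qed.

Lemma w0_pass_end (k : Z) : w0 * pass_end k = 2 * PI * IZR k - (A - 2 * eps).
Proof. unfold pass_end; field; lra. Qed.

Lemma lt_of_w0 (s t : R) : w0 * s < w0 * t -> s < t.
Proof. apply Rmult_lt_reg_l; lra. Qed.

Lemma le_of_w0 (s t : R) : w0 * s <= w0 * t -> s <= t.
Proof. apply Rmult_le_reg_l; lra. Qed.

Lemma w0_mono (s t : R) : s <= t -> w0 * s <= w0 * t.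
Proof. apply Rmult_le_compat_l; lra. Qed.

Lemma pass_start_le (k l : Z) : (k <= l)%Z -> pass_start k <= pass_start l.
Proof.
  intros Hkl. apply le_of_w0. rewrite !w0_pass_start.
  pose proof (IZR_2pi_le k l Hkl). lra.
Qed.

Lemma pass_end_lt_start (k l : Z) : (k < l)%Z -> pass_end k < pass_start l.
Proof.
  intros Hkl. apply lt_of_w0. rewrite w0_pass_start, w0_pass_end.
  pose proof (IZR_2pi_le (k + 1) l ltac:(lia)) as H. rewrite plus_IZR in H.
  pose proof PI_RGT_0. lra.
Qed.

Lemma heading_band (i : nat) (t : R) :
  (i < N)%nat -> T <= t -> A - eps <= Phi i t - w0 * t <= B + eps.
Proof. intros Hi Ht. exact (proj1 (Hband t Ht i Hi)). Qed.

Lemma pass_of_level (j : nat) (s : R) (k : Z) :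
  (j < N)%nat -> T <= s -> Phi j s = 2 * PI * IZR k -> pass_start k < s < pass_end k.
Proof.
  intros Hj Hs Hk. pose proof (heading_band j s Hj Hs) as H. rewrite Hk in H.
  split; apply lt_of_w0; rewrite ?w0_pass_start, ?w0_pass_end; lra.
Qed.

(** Every firing after [T] lies inside the pass of its own level, and distinct passes are
    disjoint. *)
Lemma quiet (i : nat) (k : Z) (u : R) :
  T <= u -> pass_end (k - 1) <= u <= pass_start k -> ~ recv i u.
Proof.
  intros HTu Hu [[j [Hj [_ [_ [l [Hl _]]]]]] _].
  pose proof (pass_of_level j u l Hj HTu Hl) as Hpass.
  destruct (Z.le_gt_cases k l) as [Hle|Hgt].
  - pose proof (pass_start_le k l Hle). lra.
  - destruct (Z.eq_dec l (k - 1)) as [->|]; [lra|].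
    pose proof (pass_end_lt_start l (k - 1) ltac:(lia)).
    pose proof (w0_pass_start (k - 1)). pose proof (w0_pass_end (k - 1)).
    assert (pass_start (k - 1) < pass_end (k - 1)) by (apply lt_of_w0; lra). lra.
Qed.

Lemma crosses_exists (i : nat) (k : Z) :
  (i < N)%nat -> T <= pass_start k -> exists tau, crosses i k tau.
Proof.
  intros Hi Hk. pose proof (w0_pass_start k) as Hs. pose proof (w0_pass_end k) as He.
  assert (Hse : pass_start k < pass_end k) by (apply lt_of_w0; lra).
  pose proof (heading_band i _ Hi Hk) as H1.
  pose proof (heading_band i (pass_end k) Hi ltac:(lra)) as H2.
  destruct (first_hit (Phi i) (pass_start k) (pass_end k) (2 * PI * IZR k))
    as [tau [Ht [Hp Hb]]]; try lra; [now apply phase_continuous|].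
  exists tau. split; auto. apply (pass_of_level i); auto; lra.
Qed.

Lemma crosses_fires (i : nat) (k : Z) (tau : R) :
  T <= pass_start k -> crosses i k tau -> fires Phi i tau.
Proof.
  intros Hk [Htau [Hp Hb]]. split; [lra|]. exists k. split; auto.
  exists (tau - pass_start k). split; [lra|]. intros u Hu. apply Hb. lra.
Qed.

Lemma fires_crosses (j : nat) (k : Z) (s : R) :
  (j < N)%nat -> T <= pass_start k -> T <= s -> fires Phi j s -> Phi j s = 2 * PI * IZR k ->
  crosses j k s.
Proof.
  intros Hj Hk Hs Hf Hp. split; [now apply (pass_of_level j)|]. split; auto.
  intros u Hu. apply (fires_first j s); auto; lra.
Qed.

Lemma crosses_below (i : nat) (k : Z) (tau u : R) :
  crosses i k tau -> pass_start k <= u <= tau -> Phi i u <= 2 * PI * IZR k.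
Proof.
  intros [_ [Hp Hb]] Hu. destruct (Req_dec u tau) as [->|Hne]; [lra|].
  apply Rlt_le, Hb. lra.
Qed.

(** From [pass_start k] on, only levels of index at least [k] can fire, so the sender is at or above
    level [k], while the receiver is at or below it. *)
Lemma pulled_up (i : nat) (k : Z) (u : R) :
  (i < N)%nat -> T <= u -> pass_start k <= u -> Phi i u <= 2 * PI * IZR k -> recv i u ->
  X i u <= G i u /\ X i u + alpha * (2 * PI * IZR k - w0 * u - X i u) <= G i u.
Proof.
  intros Hi HTu Hku Hp Hr.
  destruct (target_at_recv i u (A - eps) (B + eps) ltac:(lra) Hi ltac:(lra)
    ltac:(intros; apply Hband; auto) Hr) as [j [l [Hj [_ [Hl ->]]]]].
  pose proof (pass_of_level j u l Hj HTu Hl).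
  assert (Hkl : (k <= l)%Z).
  { apply Z.nlt_ge. intros Hlt. pose proof (pass_end_lt_start l k Hlt). lra. }
  pose proof (IZR_2pi_le k l Hkl) as Hc.
  assert (Hpos : 0 <= alpha * (2 * PI * IZR k - w0 * u - X i u)).
  { apply Rmult_le_pos; [lra|]. unfold lifted_heading. lra. }
  assert (alpha * (2 * PI * IZR k - w0 * u - X i u) <= alpha * (X j u - X i u)).
  { apply Rmult_le_compat_l; [lra|]. unfold lifted_heading. lra. }
  lra.
Qed.

Lemma uncrossed_level (i : nat) (k : Z) (tau h s t : R) :
  (i < N)%nat -> T <= pass_start k -> crosses i k tau -> pass_start k <= s <= t -> t <= tau ->
  h <= X i s -> h <= G i s -> h <= X i t /\ h <= G i t.
Proof.
  intros Hi Hk Hc Hst Ht HX HG.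
  enough (h <= X i t <= B + eps /\ h <= G i t <= B + eps) by lra.
  apply (invariant_interval (eq i) h (B + eps) s t); auto; try lra.
  - intros j Hj <-. destruct (Hband s ltac:(lra) i Hi). lra.
  - intros u Hu HXu j Hj <- Hr. specialize (HXu i Hi eq_refl).
    destruct (pulled_up i k u Hi ltac:(lra) ltac:(lra)
      ltac:(apply (crosses_below i k tau); auto; lra) Hr) as [Hup _].
    destruct (Hband u ltac:(lra) i Hi). lra.
Qed.

(** The refractory condition enters here: the receiver is below the firing level by less than
    [Lbar], so its phase exceeds 2π - Lbar, hence [D]. *)
Lemma recv_from_crossing (i j : nat) (k : Z) (s tau : R) :
  (i < N)%nat -> (j < N)%nat -> adj j i -> T <= pass_start k ->
  crosses j k s -> crosses i k tau -> s < tau -> recv i s.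
Proof.
  intros Hi Hj Hadj Hk Hcj Hci Hlt. split.
  - exists j. split; auto. split; auto. now apply (crosses_fires j k).
  - destruct Hcj as [Hs [Hpj _]]. destruct Hci as [_ [_ Hb]].
    specialize (Hb s ltac:(lra)).
    pose proof (heading_band i s Hi ltac:(lra)).
    pose proof (heading_band j s Hj ltac:(lra)).
    unfold phase. rewrite (mod2pi_eq _ (k - 1)); rewrite minus_IZR; lra.
Qed.

(** If [i] is met before [j], it is met at a higher level. Otherwise it hears [j], and while the
    level falls from A + d or higher to A + d/2 it has both a high enough target and enough time to
    climb to A + kappa d; after that it is not pulled down before being met. *)
Lemma crossing_level_step (i j : nat) (k : Z) (s tau d kappa : R) :
  (i < N)%nat -> (j < N)%nat -> adj j i -> T <= pass_start k ->
  crosses j k s -> crosses i k tau ->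
  0 < kappa -> 4 * kappa <= alpha -> 4 * kappa * w0 <= wmax ->
  0 < d -> eps <= kappa * d -> A + d <= X j s -> A + kappa * d <= X i tau.
Proof.
  intros Hi Hj Hadj Hk Hcj Hci Hk0 Hka Hkw Hd He HXj.
  assert (Hkd : 4 * (kappa * d) <= alpha * d)
    by (rewrite <- Rmult_assoc; apply Rmult_le_compat_r; lra).
  assert (Had : alpha * d <= 1 * d) by (apply Rmult_le_compat_r; lra).
  assert (HXjs : X j s = 2 * PI * IZR k - w0 * s).
  { unfold lifted_heading. now rewrite (proj1 (proj2 Hcj)). }
  assert (HXit : X i tau = 2 * PI * IZR k - w0 * tau).
  { unfold lifted_heading. now rewrite (proj1 (proj2 Hci)). }
  destruct (Rle_dec tau s) as [Hle|Hgt].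
  { pose proof (w0_mono tau s Hle). lra. }
  apply Rnot_lt_le; intros Hlow.
  (* at time [r] the level is halfway between A and A + d *)
  set (r := (2 * PI * IZR k - A - d / 2) / w0).
  assert (Hr : w0 * r = 2 * PI * IZR k - A - d / 2) by (unfold r; field; lra).
  assert (Hsr : s < r) by (apply lt_of_w0; lra).
  assert (Hrt : r < tau) by (apply lt_of_w0; lra).
  assert (Hsk := proj1 Hcj).
  assert (Hrecv : recv i s) by (apply (recv_from_crossing i j k s tau); auto; lra).
  (* Up to [r] each pulse pulls a heading of at least A - eps by the fraction [alpha] towards a
     level of at least A + d/2. The target is then at least A - eps + alpha d/2, and 4 kappa <=
     alpha and eps <= kappa d conclude. *)
  assert (HG : forall u, s <= u <= r -> A + kappa * d <= G i u).
  { intros u Hu. destruct (last_recv i u Hi ltac:(lra)) as [Hn|[v [Hv [Hrv Hl]]]].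
    { exfalso; apply (Hn s); auto; lra. }
    assert (Hsv : s <= v).
    { apply Rnot_lt_le; intros Hlt. apply (Hl s); auto; lra. }
    destruct (flow i v u Hi ltac:(lra) Hl) as [-> _].
    destruct (pulled_up i k v Hi ltac:(lra) ltac:(lra)
      ltac:(apply (crosses_below i k tau); auto; lra) Hrv) as [_ Hup].
    pose proof (w0_mono v r ltac:(lra)).
    pose proof (heading_band i v Hi ltac:(lra)) as HXv. fold (lifted_heading i v) in HXv.
    assert (Hnn : (1 - alpha) * (A - eps) <= (1 - alpha) * X i v)
      by (apply Rmult_le_compat_l; lra).
    assert (alpha * (A + d / 2) <= alpha * (2 * PI * IZR k - w0 * v))
      by (apply Rmult_le_compat_l; lra).
    assert (0 <= alpha * eps) by (apply Rmult_le_pos; lra).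
    lra. }
  pose proof (chase i (A + kappa * d) s r Hi ltac:(lra) HG) as Hchase.
  (* The level takes time at least d/(2 w0) to descend to A + d/2; the climb needed is at most eps +
     kappa d, hence at most 2 kappa d. *)
  assert (Hmove : 2 * (kappa * d) <= wmax * (r - s)).
  { apply Rle_trans with (4 * kappa * w0 * (r - s)); [|apply Rmult_le_compat_r; lra].
    replace (4 * kappa * w0 * (r - s)) with (4 * kappa * (w0 * r - w0 * s)) by ring.
    replace (2 * (kappa * d)) with (4 * kappa * (d / 2)) by field.
    apply Rmult_le_compat_l; lra. }
  pose proof (heading_band i s Hi ltac:(lra)) as HXs. fold (lifted_heading i s) in HXs.
  assert (HXr : A + kappa * d <= X i r) by minmax.
  destruct (uncrossed_level i k tau (A + kappa * d) r tau Hi Hk Hci ltac:(lra) ltac:(lra)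
    HXr (HG r ltac:(lra))). lra.
Qed.

(** Each hop away from the high robot [p] costs one factor [kappa]. *)
Lemma crossing_level (p : nat) (k : Z) (d kappa : R) :
  (p < N)%nat -> T <= pass_start k ->
  A + d <= X p (pass_start k) -> A + d <= G p (pass_start k) ->
  0 < kappa -> 4 * kappa <= alpha -> 4 * kappa * w0 <= wmax -> 0 < d ->
  forall m, eps <= kappa ^ m * d -> forall i tau, (i < N)%nat -> within m p i ->
  crosses i k tau -> A + kappa ^ m * d <= X i tau.
Proof.
  intros Hp Hk HX HG Hk0 Hka Hkw Hd m. induction m as [|m IH]; simpl.
  - intros _ i tau Hi <- Hc. rewrite Rmult_1_l. assert (Htau := proj1 Hc).
    apply (uncrossed_level p k tau (A + d) (pass_start k) tau); auto; lra.
  - intros He i tau Hi Hw Hc. rewrite Rmult_assoc in He |- *.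
    assert (Hpos : 0 < kappa ^ m * d) by (apply Rmult_lt_0_compat; auto; apply pow_lt; auto).
    assert (Hle : kappa * (kappa ^ m * d) <= 1 * (kappa ^ m * d))
      by (apply Rmult_le_compat_r; lra).
    destruct Hw as [Hw|[j [Hw [Hj [_ Hadj]]]]].
    + specialize (IH ltac:(lra) i tau Hi Hw Hc). lra.
    + destruct (crosses_exists j k Hj Hk) as [s Hs].
      apply (crossing_level_step i j k s tau); auto.
      apply IH; auto; lra.
Qed.

Lemma quiet_length (k : Z) : PI <= w0 * (pass_start k - pass_end (k - 1)).
Proof.
  rewrite Rmult_minus_distr_l, w0_pass_start, w0_pass_end, minus_IZR. lra.
Qed.

(** In the quiet period before the pass the target is fixed and the available travel exceeds 2 eps
    and is at least d + eps. A heading near the top therefore cannot still be descending, and a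
    robot with a target near the top has climbed past A + d. *)
Lemma high_robot_settled (p : nat) (k : Z) (d : R) :
  (p < N)%nat -> T <= pass_end (k - 1) ->
  B - eps < X p (pass_start k) \/ B - eps < G p (pass_start k) ->
  2 * eps * w0 < wmax * PI -> d <= B - A - eps -> (d + eps) * w0 <= wmax * PI ->
  A + d <= X p (pass_start k) /\ A + d <= G p (pass_start k).
Proof.
  intros Hp Hk Hhigh He Hd1 Hd2.
  pose proof (pass_end_lt_start (k - 1) k ltac:(lia)) as Hlt.
  set (tau := pass_start k - pass_end (k - 1)) in *.
  assert (Hreach : wmax * PI <= w0 * (wmax * tau)).
  { replace (w0 * (wmax * tau)) with (wmax * (w0 * tau)) by ring.
    apply Rmult_le_compat_l; [lra|]. apply quiet_length. }
  assert (He' : 2 * eps < wmax * tau) by (apply lt_of_w0; lra).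
  assert (Hd' : d + eps <= wmax * tau) by (apply le_of_w0; lra).
  destruct (flow p (pass_end (k - 1)) (pass_start k) Hp ltac:(lra)
    ltac:(intros u Hu; apply (quiet p k u); lra)) as [HG HX].
  fold tau in HX. rewrite HG, HX in *.
  destruct (Hband _ Hk p Hp) as [HXb HGb].
  minmax.
Qed.

Lemma level_after_passes (k0 k1 : Z) (d : R) :
  (k0 < k1)%Z -> T <= pass_start k0 -> PI <= wmax * (pass_start (k1 - 1) - pass_start k0) ->
  (forall k, (k0 <= k)%Z -> forall i tau, (i < N)%nat -> crosses i k tau -> A + d <= X i tau) ->
  forall i, (i < N)%nat -> A + d <= X i (pass_start k1) /\ A + d <= G i (pass_start k1).
Proof.
  intros Hk01 HTk Hlong Hcross i Hi.
  set (t := pass_start k1) in *.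
  pose proof (pass_start_le k0 k1 ltac:(lia)) as Hle. fold t in Hle.
  assert (Hmove0 : forall y z, y <= z -> 0 <= wmax * (z - y))
    by (intros; apply Rmult_le_pos; lra).
  (* Without a pulse since [pass_start k0], the robot has reached its target before it is met in
     pass [k1 - 1], as the distance was at most π. Its target is therefore the level at which it was
     met. *)
  assert (Hstale : (forall u, pass_start k0 < u <= t -> ~ recv i u) ->
    A + d <= X i t /\ A + d <= G i t).
  { intros Hno.
    pose proof (pass_start_le k0 (k1 - 1) ltac:(lia)) as Hle'.
    pose proof (pass_end_lt_start (k1 - 1) k1 ltac:(lia)) as Hlt. fold t in Hlt.
    destruct (crosses_exists i (k1 - 1) Hi ltac:(lra)) as [tau Hc].
    pose proof (Hcross (k1 - 1)%Z ltac:(lia) i tau Hi Hc) as Hd.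
    assert (Htau := proj1 Hc).
    destruct (flow i (pass_start k0) tau Hi ltac:(lra) ltac:(intros; apply Hno; lra)) as [HG HX].
    destruct (flow i tau t Hi ltac:(lra) ltac:(intros; apply Hno; lra)) as [HG' HX'].
    assert (PI <= wmax * (tau - pass_start k0)).
    { apply Rle_trans with (1 := Hlong). apply Rmult_le_compat_l; lra. }
    destruct (Hband (pass_start k0) HTk i Hi) as [HXb HGb].
    assert (HXG : X i tau = G i (pass_start k0)) by (rewrite HX; minmax).
    rewrite HG', HX', HG. rewrite HXG in *.
    pose proof (Hmove0 tau t ltac:(lra)). split; minmax. }
  destruct (last_recv i t Hi ltac:(lra)) as [Hn|[s [Hs [Hr Hl]]]].
  { apply Hstale. intros u Hu. apply Hn. lra. }
  destruct (Rle_dec s (pass_start k0)) as [Hsk|Hsk].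
  { apply Hstale. intros u Hu. apply Hl. lra. }
  destruct (target_at_recv i s (A - eps) (B + eps) ltac:(lra) Hi ltac:(lra)
    ltac:(intros; apply Hband; auto; lra) Hr) as [j [k [Hj [Hf [Hp HG]]]]].
  pose proof (pass_of_level j s k Hj ltac:(lra) Hp) as Hpass.
  assert (Hk0 : (k0 <= k)%Z).
  { apply Z.nlt_ge. intros Hlt. pose proof (pass_end_lt_start k k0 Hlt). lra. }
  assert (Hk1 : (k < k1)%Z).
  { apply Z.nle_gt. intros Hge. pose proof (pass_start_le k1 k Hge). fold t in H. lra. }
  pose proof (pass_start_le k0 k Hk0) as Hle0.
  pose proof (pass_end_lt_start k k1 Hk1) as Hlt. fold t in Hlt.
  assert (Hcj : crosses j k s) by (apply fires_crosses; auto; lra).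
  pose proof (Hcross k Hk0 j s Hj Hcj) as HXj.
  destruct (crosses_exists i k Hi ltac:(lra)) as [tau Hc].
  pose proof (Hcross k Hk0 i tau Hi Hc) as HXi.
  assert (Htau := proj1 Hc).
  destruct (Rle_dec tau s) as [Hts|Hts].
  (* The receiver has already been met in this pass and stays at or above the level by [no_return];
     its target lies between its own heading and the sender's. *)
  - assert (HXs : X j s <= X i s).
    { unfold lifted_heading. rewrite Hp.
      pose proof (no_return i k tau s Hi ltac:(lra) ltac:(rewrite (proj1 (proj2 Hc)); lra)).
      lra. }
    destruct (flow i s t Hi ltac:(lra) Hl) as [HG' HX'].
    pose proof (convex_bounds alpha (X j s) (X i s) (X i s) (X j s) ltac:(lra) ltac:(lra)
      ltac:(lra)).
    pose proof (Hmove0 s t ltac:(lra)).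
    rewrite HG', HX', HG. split; minmax.
  (* The receiver is yet to be met. It is pulled up and hears nothing more, so its target is at
     least its heading when met. *)
  - destruct (pulled_up i k s Hi ltac:(lra) ltac:(lra)
      ltac:(apply (crosses_below i k tau); auto; lra) Hr) as [Hup _].
    destruct (flow i s tau Hi ltac:(lra) ltac:(intros; apply Hl; lra)) as [HG1 HX1].
    destruct (flow i tau t Hi ltac:(lra) ltac:(intros; apply Hl; lra)) as [HG2 HX2].
    pose proof (Hmove0 s tau ltac:(lra)). pose proof (Hmove0 tau t ltac:(lra)).
    assert (X i tau <= G i s) by (rewrite HX1; minmax).
    rewrite HG2, HX2, HG1. split; minmax.
Qed.

End Passes.

(** * Collapse of the limiting band *)

Lemma headings_gather (a0 b0 : R) :
  (1 <= N)%nat -> strongly_connected N adj -> b0 - a0 < Lbar -> in_band 0 a0 b0 ->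
  forall e, 0 < e -> exists T, 0 <= T /\ forall t, T <= t ->
    exists c, forall i, (i < N)%nat -> c <= X i t <= c + e.
Proof.
  intros HN Hconn Hw Hinit.
  assert (Hband0 : forall t, 0 <= t -> in_band t a0 b0).
  { intros t Ht. apply (band_invariant a0 b0 0 t); auto; lra. }
  destruct (completeness (fun a => exists t, 0 <= t /\
      forall i, (i < N)%nat -> a <= X i t /\ a <= G i t)) as [A [HAub HAlub]].
  { exists b0. intros a [t [Ht Ha]].
    destruct (Ha 0%nat HN). destruct (Hband0 t Ht 0%nat HN). lra. }
  { exists a0, 0. split; [lra|]. intros i Hi. destruct (Hinit i Hi). lra. }
  (* The infimum of the upper bounds, obtained as a supremum after a change of sign. *)
  destruct (completeness (fun b => exists t, 0 <= t /\
      forall i, (i < N)%nat -> X i t <= - b /\ G i t <= - b)) as [B' [HBub HBlub]].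
  { exists (- a0). intros b [t [Ht Hb]].
    destruct (Hb 0%nat HN). destruct (Hband0 t Ht 0%nat HN). lra. }
  { exists (- b0), 0. split; [lra|]. intros i Hi. destruct (Hinit i Hi). lra. }
  set (B := - B'). replace B' with (- B) in * by (unfold B; ring). clearbody B. clear B'.
  assert (HA0 : a0 <= A).
  { apply HAub. exists 0. split; [lra|]. intros i Hi. destruct (Hinit i Hi). lra. }
  assert (HB0 : B <= b0).
  { enough (- b0 <= - B) by lra. apply HBub.
    exists 0. split; [lra|]. intros i Hi. destruct (Hinit i Hi). lra. }
  assert (Htail : forall eps, 0 < eps -> exists T, 0 <= T /\
      forall t, T <= t -> in_band t (A - eps) (B + eps)).
  { intros eps Heps.
    (* Each improved bound is paired with an initial one, so that the band is narrower than π and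
       [band_invariant] applies. *)
    assert (H1 : exists t, 0 <= t /\ in_band t (Rmax a0 (A - eps)) b0).
    { apply NNPP; intros Hn. enough (A <= A - eps) by lra.
      apply HAlub. intros a [t [Ht Ha]]. apply Rnot_lt_le; intros Hlt.
      apply Hn. exists t. split; auto. intros i Hi.
      destruct (Ha i Hi). destruct (Hband0 t Ht i Hi). minmax. }
    assert (H2 : exists t, 0 <= t /\ in_band t a0 (Rmin b0 (B + eps))).
    { apply NNPP; intros Hn. enough (- B <= - (B + eps)) by lra.
      apply HBlub. intros b [t [Ht Hb]]. apply Rnot_lt_le; intros Hlt.
      apply Hn. exists t. split; auto. intros i Hi.
      destruct (Hb i Hi). destruct (Hband0 t Ht i Hi). minmax. }
    destruct H1 as [t1 [Ht1 H1]]. destruct H2 as [t2 [Ht2 H2]].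
    exists (Rmax t1 t2). split; [minmax|]. intros t Ht i Hi.
    assert (Ht' : t1 <= t /\ t2 <= t) by (clear - Ht; minmax).
    pose proof (Rmax_l a0 (A - eps)). pose proof (Rmax_r a0 (A - eps)).
    pose proof (Rmin_l b0 (B + eps)). pose proof (Rmin_r b0 (B + eps)).
    destruct (band_invariant (Rmax a0 (A - eps)) b0 t1 t ltac:(lra) ltac:(lra) H1 i Hi).
    destruct (band_invariant a0 (Rmin b0 (B + eps)) t2 t ltac:(lra) ltac:(lra) H2 i Hi).
    lra. }
  assert (HAB : A <= B).
  { apply Rnot_lt_le; intros Hlt.
    destruct (Htail ((A - B) / 4) ltac:(lra)) as [T [HT H]].
    destruct (H T ltac:(lra) 0%nat HN). lra. }
  destruct (Rle_lt_or_eq_dec A B HAB) as [Hlt|<-].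
  2:{ intros e He. destruct (Htail (e / 2) ltac:(lra)) as [T [HT H]].
      exists T. split; auto. intros t Ht. exists (A - e / 2). intros i Hi.
      destruct (H t Ht i Hi). lra. }
  exfalso. pose proof PI_RGT_0 as Hpi.
  destruct (within_uniform Hconn) as [K HK].
  (* The first term leaves room for [d <= B - A - eps]; the second is half of the travel possible in
     a quiet period, the other half absorbing [eps]. *)
  set (d := Rmin ((B - A) / 2) (wmax * PI / (2 * w0))).
  assert (Hd : 0 < d).
  { apply Rmin_glb_lt; [lra|]. apply Rdiv_lt_0_compat; [|lra]. apply Rmult_lt_0_compat; lra. }
  assert (Hd1 : d <= (B - A) / 2) by apply Rmin_l.
  assert (Hd2 : d * w0 <= wmax * PI / 2).
  { apply Rle_trans with (wmax * PI / (2 * w0) * w0); [|right; field; lra].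
    apply Rmult_le_compat_r; [lra|apply Rmin_r]. }
  set (kappa := Rmin (alpha / 4) (wmax / (4 * w0))).
  assert (Hk : 0 < kappa).
  { apply Rmin_glb_lt; [lra|]. apply Rdiv_lt_0_compat; lra. }
  assert (Hka : 4 * kappa <= alpha).
  { enough (kappa <= alpha / 4) by lra. apply Rmin_l. }
  assert (Hkw : 4 * kappa * w0 <= wmax).
  { apply Rle_trans with (4 * (wmax / (4 * w0)) * w0); [|right; field; lra].
    apply Rmult_le_compat_r; [lra|]. apply Rmult_le_compat_l; [lra|apply Rmin_r]. }
  assert (HdK : 0 < kappa ^ K * d) by (apply Rmult_lt_0_compat; auto; apply pow_lt; auto).
  (* In turn: [eps] is below the gain after [K] hops, the widened band fits in [Lbar], and [eps] is
     small compared with [d]. *)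
  set (eps := Rmin (kappa ^ K * d) (Rmin ((Lbar - (b0 - a0)) / 4) (d / 2))).
  assert (Heps : 0 < eps) by (repeat apply Rmin_glb_lt; lra).
  assert (He1 : eps <= kappa ^ K * d) by apply Rmin_l.
  assert (He2 : eps <= (Lbar - (b0 - a0)) / 4)
    by (eapply Rle_trans; [apply Rmin_r|apply Rmin_l]).
  assert (He3 : eps <= d / 2) by (eapply Rle_trans; [apply Rmin_r|apply Rmin_r]).
  clearbody eps d kappa.
  destruct (Htail eps Heps) as [T [HT Hband]].
  assert (Hwidth : B - A + 4 * eps <= Lbar) by lra.
  assert (Hew : eps * w0 <= d / 2 * w0) by (apply Rmult_le_compat_r; lra).
  assert (Hwpi : 0 < wmax * PI) by (apply Rmult_lt_0_compat; lra).
  (* The quiet period before pass [k0] already lies after [T]. *)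
  set (k0 := (up ((w0 * T + (A - 2 * eps)) / (2 * PI)) + 1)%Z).
  assert (Hk0 : T <= pass_end A eps (k0 - 1)).
  { apply le_of_w0. rewrite w0_pass_end. unfold k0.
    replace (up ((w0 * T + (A - 2 * eps)) / (2 * PI)) + 1 - 1)%Z
      with (up ((w0 * T + (A - 2 * eps)) / (2 * PI))) by lia.
    destruct (archimed ((w0 * T + (A - 2 * eps)) / (2 * PI))) as [Hup _].
    apply (Rmult_lt_compat_l (2 * PI)) in Hup; [|lra].
    replace (2 * PI * ((w0 * T + (A - 2 * eps)) / (2 * PI)))
      with (w0 * T + (A - 2 * eps)) in Hup by (field; lra). lra. }
  (* In [n] revolutions, lasting 2π n/w0, a robot can travel more than π, enough to reach any stale
     target. *)
  set (n := up (w0 / wmax)).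
  assert (Hn : w0 / wmax < IZR n) by (apply archimed).
  assert (Hn0 : 0 < w0 / wmax) by (apply Rdiv_lt_0_compat; lra).
  assert (Hnpos : (0 < n)%Z) by (apply lt_IZR; lra).
  clearbody k0 n.
  set (start := pass_start B eps).
  assert (Hend : forall k, (k0 <= k)%Z -> T <= pass_end A eps (k - 1)).
  { intros k Hkk. apply le_of_w0. apply w0_mono in Hk0.
    rewrite w0_pass_end in *. pose proof (IZR_2pi_le (k0 - 1) (k - 1) ltac:(lia)). lra. }
  assert (Hstart : forall k, (k0 <= k)%Z -> T <= start k).
  { intros k Hkk. specialize (Hend k Hkk).
    pose proof (pass_end_lt_start A B eps HAB Heps Hwidth (k - 1) k ltac:(lia)).
    unfold start. lra. }
  assert (Hcross : forall k, (k0 <= k)%Z -> forall i tau, (i < N)%nat ->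
      crosses A B eps i k tau -> A + kappa ^ K * d <= X i tau).
  { intros k Hkk i tau Hi Hc. specialize (Hend k Hkk). specialize (Hstart k Hkk).
    (* Otherwise B - eps would bound all headings and targets from above, against the choice of
       [B]. *)
    assert (Hp : exists p, (p < N)%nat /\ (B - eps < X p (start k) \/ B - eps < G p (start k))).
    { apply NNPP; intros Hnone. enough (- (B - eps) <= - B) by lra.
      apply HBub. exists (start k). split; [lra|]. intros p Hp.
      split; apply Rnot_lt_le; intros Hl; apply Hnone; exists p; split; auto; lra. }
    destruct Hp as [p [Hp Hhigh]].
    destruct (high_robot_settled A B eps T HAB Heps Hwidth HT Hband p k d Hp Hend Hhigh)
      as [HXp HGp]; try lra.
    apply (crossing_level A B eps T HAB Heps Hwidth HT Hband p k); auto. }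
  enough (A + kappa ^ K * d <= A) by lra.
  apply HAub. exists (start (k0 + n + 1)%Z). split.
  { specialize (Hstart (k0 + n + 1)%Z ltac:(lia)). lra. }
  apply (level_after_passes A B eps T HAB Heps Hwidth HT Hband k0); auto.
  - lia.
  - apply Hstart. lia.
  - apply le_of_w0.
    replace (w0 * (wmax * (pass_start B eps (k0 + n + 1 - 1) - pass_start B eps k0)))
      with (wmax * (w0 * pass_start B eps (k0 + n + 1 - 1) - w0 * pass_start B eps k0)) by ring.
    rewrite !w0_pass_start.
    replace (k0 + n + 1 - 1)%Z with (k0 + n)%Z by lia. rewrite plus_IZR.
    replace (wmax * (2 * PI * (IZR k0 + IZR n) - (B + 2 * eps) - (2 * PI * IZR k0 - (B + 2 * eps))))
      with (2 * (PI * (wmax * IZR n))) by ring.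
    assert (w0 < wmax * IZR n).
    { replace w0 with (wmax * (w0 / wmax)) by (field; lra). apply Rmult_lt_compat_l; lra. }
    assert (PI * w0 <= PI * (wmax * IZR n)) by (apply Rmult_le_compat_l; lra).
    assert (0 <= PI * w0) by (apply Rmult_le_pos; lra).
    lra.
Qed.

End Execution.

(** * Lifting an arc to an interval *)

Lemma fires_shift (Phi : nat -> R -> R) (n : nat -> Z) (j : nat) (t : R) :
  fires (fun i u => Phi i u + 2 * PI * IZR (n i)) j t <-> fires Phi j t.
Proof.
  split; intros [Ht [k [Hk [e [He Hb]]]]]; split; auto.
  - exists (k - n j)%Z. rewrite minus_IZR. split; [lra|]. exists e; split; auto.
    intros u Hu. specialize (Hb u Hu). lra.
  - exists (k + n j)%Z. rewrite plus_IZR. split; [lra|]. exists e; split; auto.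
    intros u Hu. specialize (Hb u Hu). lra.
Qed.

Lemma receives_shift (N : nat) (adj : nat -> nat -> Prop) (D : R) (Phi : nat -> R -> R)
    (n : nat -> Z) (i : nat) (t : R) :
  receives N adj D (fun i u => Phi i u + 2 * PI * IZR (n i)) i t <-> receives N adj D Phi i t.
Proof.
  unfold receives, phase. rewrite mod2pi_shift.
  split; intros [[j [Hj [Ha Hf]]] Hr]; split; auto; exists j; repeat split; auto;
    apply (fires_shift Phi n j t) in Hf; apply Hf.
Qed.

(** Only increments, phases and crossings of multiples of 2π matter, so each robot may be lifted by
    its own number of turns. *)
Lemma execution_shift (N : nat) (adj : nat -> nat -> Prop) (w0 wmax alpha D : R)
    (theta0 : nat -> R) (Phi om : nat -> R -> R) (n : nat -> Z) :
  is_execution N adj w0 wmax alpha D theta0 Phi om ->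
  is_execution N adj w0 wmax alpha D (fun i => theta0 i + 2 * PI * IZR (n i))
    (fun i t => Phi i t + 2 * PI * IZR (n i)) om.
Proof.
  intros H i Hi. destruct (H i Hi) as [H0 [Hc [Hd Hr]]]. split; [lra|]. split; [|split].
  - intros t Ht e He. destruct (Hc t Ht e He) as [d [Hd0 Hu]]. exists d; split; auto.
    intros u Hu0 Hut.
    replace (Phi i u + 2 * PI * IZR (n i) - (Phi i t + 2 * PI * IZR (n i)))
      with (Phi i u - Phi i t) by ring. auto.
  - intros t Ht e He. destruct (Hd t Ht e He) as [d [Hd0 Hh]]. exists d; split; auto.
    intros h Hh0.
    replace (Phi i (t + h) + 2 * PI * IZR (n i) - (Phi i t + 2 * PI * IZR (n i)))
      with (Phi i (t + h) - Phi i t) by ring. auto.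
  - intros t Ht. destruct (Hr t Ht) as [[Hn Ho]|[s [Hs [Hrs [Hl Ho]]]]].
    + left. split; auto. intros s Hs. rewrite receives_shift. auto.
    + right. exists s. split; auto. rewrite receives_shift. split; auto. split.
      * intros u Hu. rewrite receives_shift. auto.
      * unfold phase. rewrite mod2pi_shift. exact Ho.
Qed.

(** * Sorted values and their gaps *)

Lemma in_rinsert (x y : R) (l : list R) : In y (rinsert x l) <-> y = x \/ In y l.
Proof.
  induction l as [|z l IH]; simpl; [intuition|].
  destruct (Rle_dec x z); simpl; rewrite ?IH; intuition.
Qed.

Lemma in_rsort (y : R) (l : list R) : In y (rsort l) <-> In y l.
Proof.
  induction l as [|x l IH]; simpl; [tauto|]. rewrite in_rinsert, IH. intuition.
Qed.

Lemma rinsert_sorted (x : R) (l : list R) :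
  StronglySorted Rle l -> StronglySorted Rle (rinsert x l).
Proof.
  induction 1 as [|z l Hl IH Hz]; simpl; [repeat constructor|].
  rewrite Forall_forall in Hz. destruct (Rle_dec x z) as [Hxz|Hxz].
  - constructor; [constructor; auto; now apply Forall_forall|].
    apply Forall_forall. intros y [<-|Hy]; auto. specialize (Hz y Hy). lra.
  - constructor; auto. apply Forall_forall. intros y Hy.
    apply in_rinsert in Hy. destruct Hy as [->|Hy]; auto. lra.
Qed.

Lemma rsort_sorted (l : list R) : StronglySorted Rle (rsort l).
Proof. induction l; simpl; [constructor|now apply rinsert_sorted]. Qed.

Lemma in_hd (s : list R) : s <> [] -> In (hd 0 s) s.
Proof. destruct s; simpl; tauto. Qed.

Lemma in_last (s : list R) : s <> [] -> In (last s 0) s.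
Proof.
  induction s as [|x [|y s] IH]; [tauto|simpl; auto|].
  intros _. right. apply IH. discriminate.
Qed.

Lemma sorted_hd_last (s : list R) (x : R) :
  StronglySorted Rle s -> In x s -> hd 0 s <= x <= last s 0.
Proof.
  intros Hs. revert x. induction Hs as [|y s Hs IH Hy]; [simpl; tauto|].
  rewrite Forall_forall in Hy. intros x Hx.
  destruct s as [|z s].
  - destruct Hx as [->|[]]. simpl; lra.
  - assert (Hl : last (y :: z :: s) 0 = last (z :: s) 0) by reflexivity.
    rewrite Hl. simpl hd. destruct Hx as [<-|Hx].
    + split; [lra|]. apply Rle_trans with z; [apply Hy; simpl; auto|].
      apply IH. simpl; auto.
    + specialize (IH x Hx). split; [now apply Hy|lra].
Qed.

Lemma in_diffs (s : list R) (d : R) :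
  StronglySorted Rle s -> In d (diffs s) ->
  exists x y, In x s /\ In y s /\ d = y - x /\ forall z, In z s -> z <= x \/ y <= z.
Proof.
  induction 1 as [|a s Hs IH Ha]; [simpl; tauto|].
  rewrite Forall_forall in Ha. destruct s as [|b s]; [simpl; tauto|].
  intros [<-|Hd].
  - exists a, b. split; [simpl; auto|]. split; [simpl; auto|]. split; auto.
    intros z [<-|Hz]; [left; lra|right].
    apply (sorted_hd_last (b :: s)) in Hz; auto. simpl in Hz. lra.
  - destruct (IH Hd) as [x [y [Hx [Hy [He H]]]]].
    exists x, y. split; [simpl; auto|]. split; [simpl; auto|]. split; auto.
    intros z [<-|Hz]; auto.
Qed.

(** A discrete intermediate value argument: the list starts at or below [u], later reaches [v], and
    has no entry in between, so two consecutive entries straddle the hole. *)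
Lemma diffs_jump (s : list R) (u v y : R) :
  hd 0 s <= u -> In y s -> v <= y -> u < v -> (forall z, In z s -> z <= u \/ v <= z) ->
  exists d, In d (diffs s) /\ v - u <= d.
Proof.
  intros Hh Hy Hvy Huv. induction s as [|a s IH]; [destruct Hy|].
  intros H. simpl in Hh. destruct s as [|b s].
  - destruct Hy as [->|[]]. lra.
  - destruct (H b ltac:(simpl; auto)) as [Hb|Hb].
    + destruct IH as [d [Hd Hvd]]; auto.
      * destruct Hy as [<-|Hy]; auto; lra.
      * intros z Hz. apply H. simpl; auto.
      * exists d. split; auto. simpl. auto.
    + exists (b - a). split; [simpl; auto|]. lra.
Qed.

Lemma fold_Rmax_ge (g : list R) (y : R) : In y g -> y <= fold_right Rmax 0 g.
Proof.
  induction g as [|z g IH]; simpl; [tauto|]. intros [->|Hy]; [apply Rmax_l|].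
  eapply Rle_trans; [apply IH; auto|apply Rmax_r].
Qed.

Lemma fold_Rmax_le (g : list R) (M : R) :
  0 <= M -> (forall y, In y g -> y <= M) -> fold_right Rmax 0 g <= M.
Proof.
  intros HM. induction g as [|z g IH]; simpl; auto. intros H. apply Rmax_lub; auto.
Qed.

Lemma fold_Rmax_in (g : list R) : 0 < fold_right Rmax 0 g -> In (fold_right Rmax 0 g) g.
Proof.
  induction g as [|z g IH]; simpl; [lra|].
  destruct (Rle_dec z (fold_right Rmax 0 g)) as [Hle|Hle].
  - rewrite Rmax_right by lra. auto.
  - rewrite Rmax_left by lra. auto.
Qed.

(** The circle is cut in its largest gap. If the gap runs from [x] to [y], the entries below [y] are
    moved up by one turn; if it is the wrap-around gap, nothing moves. *)
Lemma arc_length_unwrap (l : list R) (L : R) :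
  0 < L <= PI -> arc_length l < L -> (forall x, In x l -> 0 <= x < 2 * PI) ->
  exists lo hi, hi - lo < L /\
    forall x, In x l -> lo <= x + 2 * PI * IZR (if Rlt_dec x lo then 1 else 0) <= hi.
Proof.
  intros HL Harc Hrange. unfold arc_length in Harc.
  set (s := rsort l) in *. pose proof (rsort_sorted l) as Hsort. fold s in Hsort.
  pose proof PI_RGT_0 as Hpi.
  (* The maximum exceeds π, so it is a genuine gap and not the default 0 of the fold. *)
  pose proof (fold_Rmax_in (gaps s) ltac:(lra)) as Hin.
  set (g := fold_right Rmax 0 (gaps s)) in *. unfold gaps in Hin.
  apply in_app_or in Hin. destruct Hin as [Hin|[Hg|[]]].
  - destruct (in_diffs s g Hsort Hin) as [x [y [Hx [Hy [Hg Hsep]]]]].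
    exists y, (x + 2 * PI). split; [lra|].
    intros z Hz. assert (Hz' := Hrange z Hz).
    apply -> in_rsort in Hx. apply -> in_rsort in Hy.
    assert (Hx' := Hrange x Hx). assert (Hy' := Hrange y Hy).
    apply <- in_rsort in Hz. destruct (Rlt_dec z y) as [Hzy|Hzy].
    + destruct (Hsep z Hz); lra.
    + lra.
  - exists (hd 0 s), (last s 0). split; [lra|].
    intros z Hz. apply <- in_rsort in Hz.
    pose proof (sorted_hd_last s z Hsort Hz). destruct Rlt_dec; lra.
Qed.

(** Modulo 2π the arc is [c', c' + L], possibly wrapping past 2π. If the values use both pieces, the
    hole between the pieces is a gap of length at least 2π - L; otherwise the wrap-around gap is
    that long. *)
Lemma arc_length_bound (l : list R) (c L : R) :
  l <> [] -> 0 <= L < 2 * PI ->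
  (forall y, In y l -> 0 <= y < 2 * PI /\ exists k : Z, c <= y + 2 * PI * IZR k <= c + L) ->
  Rabs (arc_length l) <= L.
Proof.
  intros Hne HL Hl. unfold arc_length.
  set (s := rsort l). pose proof (rsort_sorted l) as Hsort. fold s in Hsort.
  assert (Hs : forall y, In y s ->
    0 <= y < 2 * PI /\ exists k : Z, c <= y + 2 * PI * IZR k <= c + L).
  { intros y Hy. apply Hl. now apply in_rsort. }
  assert (Hsne : s <> []).
  { destruct l as [|x l]; [tauto|]. intros He.
    assert (In x s) by (apply in_rsort; simpl; auto). rewrite He in H. destruct H. }
  assert (Hhd := in_hd s Hsne). assert (Hlast := in_last s Hsne).
  pose proof (sorted_hd_last s _ Hsort Hhd) as Hhl.
  pose proof (proj1 (Hs _ Hhd)) as Hhd'. pose proof (proj1 (Hs _ Hlast)) as Hlast'.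
  assert (Hup : fold_right Rmax 0 (gaps s) <= 2 * PI).
  { apply fold_Rmax_le; [lra|]. intros g Hg. apply in_app_or in Hg.
    destruct Hg as [Hg|[<-|[]]]; [|lra].
    destruct (in_diffs s g Hsort Hg) as [x [y [Hx [Hy [-> _]]]]].
    destruct (Hs x Hx). destruct (Hs y Hy). lra. }
  assert (Hlow : exists g, In g (gaps s) /\ 2 * PI - L <= g).
  { destruct (mod2pi_spec c) as [Hc [kc Hkc]]. set (c' := mod2pi c) in *.
    assert (Hsplit : forall y, In y s -> c' <= y <= c' + L \/ y <= c' + L - 2 * PI).
    { intros y Hy. destruct (Hs y Hy) as [Hy1 [k Hk]].
      assert (Hk1 : (kc <= k + 1)%Z) by (apply IZR_lt_of_2pi; rewrite plus_IZR; lra).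
      assert (Hk2 : (k <= kc + 1)%Z) by (apply IZR_lt_of_2pi; rewrite plus_IZR; lra).
      assert (Hk3 : k = kc \/ k = (kc + 1)%Z \/ k = (kc - 1)%Z) by lia.
      destruct Hk3 as [-> | [-> | ->]]; rewrite ?plus_IZR, ?minus_IZR in Hk; lra. }
    destruct (Hsplit _ Hhd) as [H1|H1].
    - exists (2 * PI - (last s 0 - hd 0 s)). split.
      + apply in_or_app. right. simpl; auto.
      + destruct (Hsplit _ Hlast); lra.
    - destruct (Hsplit _ Hlast) as [H2|H2].
      + destruct (diffs_jump s (c' + L - 2 * PI) c' (last s 0)) as [g [Hg Hgl]]; auto; try lra.
        * intros z Hz. destruct (Hsplit z Hz); lra.
        * exists g. split; [|lra]. apply in_or_app; auto.
      + exists (2 * PI - (last s 0 - hd 0 s)). split; [|lra].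
        apply in_or_app. right. simpl; auto. }
  destruct Hlow as [g [Hg Hgl]]. pose proof (fold_Rmax_ge _ _ Hg). apply Rabs_le. lra.
Qed.

Theorem theorem1
  (N : nat) (adj : nat -> nat -> Prop)
  (w0 wmax alpha D Lbar : R) (theta0 : nat -> R)
  (Phi om : nat -> R -> R)
  (HN : (1 <= N)%nat)
  (Hirr : forall i, ~ adj i i)
  (Hconn : strongly_connected N adj)
  (Hw0 : 0 < w0) (Hwmax : 0 < wmax)
  (Halpha : 0 < alpha <= 1)
  (HD : 0 <= D < 2 * PI)
  (HLbar : 0 < Lbar <= PI)
  (HDL : D <= 2 * PI - Lbar)
  (Htheta0 : forall i, (i < N)%nat -> 0 <= theta0 i < 2 * PI)
  (Hinit : arc_length (map theta0 (seq 0 N)) < Lbar)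
  (Hexec : is_execution N adj w0 wmax alpha D theta0 Phi om) :
  (forall eps, 0 < eps -> exists T, 0 <= T /\ forall t, T <= t ->
      Rabs (arc_length (headings_at N w0 Phi t)) < eps)
  /\
  (forall i, (i < N)%nat -> forall t1 t2, 0 <= t1 -> 0 <= t2 ->
      Rabs ((Phi i t2 - w0 * t2) - (Phi i t1 - w0 * t1)) <= wmax * Rabs (t2 - t1)).
Proof.
  pose proof PI_RGT_0 as Hpi. split.
  - intros eps Heps.
    destruct (arc_length_unwrap _ Lbar HLbar Hinit) as [lo [hi [Hw Hband]]].
    { intros x Hx. apply in_map_iff in Hx. destruct Hx as [i [<- Hi]].
      apply in_seq in Hi. apply Htheta0. lia. }
    set (n := fun i => if Rlt_dec (theta0 i) lo then 1%Z else 0%Z).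
    pose proof (execution_shift N adj w0 wmax alpha D theta0 Phi om n Hexec) as Hexec'.
    (* Half of [eps] gives the strict inequality, and the cap at π meets the requirement of
       [arc_length_bound] that the arc be shorter than the circle. *)
    set (e := Rmin (eps / 2) PI).
    assert (He : 0 < e <= eps / 2 /\ e <= PI).
    { unfold e. split; [split|].
      - apply Rmin_glb_lt; lra.
      - apply Rmin_l.
      - apply Rmin_r. }
    destruct (headings_gather N adj w0 wmax alpha D _ _ om Hw0 Hwmax Halpha Hexec'
      Lbar HD HLbar HDL lo hi HN Hconn Hw) with (e := e) as [T [HT H]]; [|lra|].
    { apply (initial_band N adj w0 wmax alpha D _ _ om Hexec').
      intros i Hi. apply Hband. apply in_map, in_seq. lia. }
    exists T. split; auto. intros t Ht. destruct (H t Ht) as [c Hc].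
    apply Rle_lt_trans with e; [|lra].
    apply arc_length_bound with c; [|lra|].
    + unfold headings_at. destruct N; [lia|discriminate].
    + intros y Hy. apply in_map_iff in Hy. destruct Hy as [i [<- Hi]].
      apply in_seq in Hi. unfold heading.
      destruct (mod2pi_spec (Phi i t - w0 * t)) as [Hm [k Hk]]. split; auto.
      exists (k + n i)%Z. rewrite plus_IZR.
      specialize (Hc i ltac:(lia)). unfold lifted_heading in Hc. lra.
  - intros i Hi t1 t2 Ht1 Ht2. destruct (Rle_dec t1 t2) as [Hle|Hle].
    + rewrite (Rabs_pos_eq (t2 - t1)) by lra.
      now apply (heading_rate N adj w0 wmax alpha D theta0 Phi om Hwmax Hexec).
    + rewrite Rabs_minus_sym, (Rabs_minus_sym t2 t1), (Rabs_pos_eq (t1 - t2)) by lra.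
      apply (heading_rate N adj w0 wmax alpha D theta0 Phi om Hwmax Hexec); auto; lra.
Qed.
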